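(* Let $T>0$. (i) For any function $f:[0,T]^2\to\mathbb{R}$ and any rectangle $R\subset[0,T]^2$, $$|f|_{1\text{-var};R}=V_1(f;R).$$ (ii) Let $p\in[1,\infty)$ and $\varepsilon>0$. There exists a constant $c=c(p,\varepsilon)\ge 1$ such that, for any function $f:[0,T]^2\to\mathbb{R}$ and any rectangle $R\subset[0,T]^2$, $$\frac{1}{c(p,\varepsilon)}\,|f|_{(p+\varepsilon)\text{-var};R}\;\le\; V_p(f;R)\;\le\;|f|_{p\text{-var};R}.$$ (iii) Let $p\in[1,\infty)$. If $f:[0,T]^2\to\mathbb{R}$ is of finite controlled $p$-variation, then the map $R\mapsto |f|_{p\text{-var};R}^{p}$ is super-additive. (iv) Let $p\in[1,\infty)$. If $f:[0,T]^2\to\mathbb{R}$ is continuous and of finite controlled $p$-variation, then the map $R\mapsto |f|_{p\text{-var};R}^{p}$ is a 2D control. Thus, in particular, there exists a 2D control $\omega$ such that $|f(R)|^p\le\omega(R)$ for all rectangles $R\subset[0,T]^2$.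
   Context: Let $\Delta_T=\{(s,t):0\le s\le t\le T\}$. A point $((a,b),(c,d))\in\Delta_T\times\Delta_T$ is identified with the closed rectangle $[a,b]\times[c,d]\subset[0,T]^2$; ''rectangle'' always means one of these. The rectangle is called degenerate if $a=b$ or $c=d$. Two rectangles are essentially disjoint if their intersection is empty or degenerate. A partition of a rectangle $R$ is a finite set of (pairwise) essentially disjoint rectangles whose union is $R$; $\mathcal{P}(R)$ denotes the set of all partitions of $R$. For $f:[0,T]^2\to\mathbb{R}$ and a rectangle $A=[a,b]\times[c,d]$, the rectangular increment is $$f(A):=f(b,d)-f(a,d)-f(b,c)+f(a,c).$$ A dissection of an interval $[a,b]\subset[0,T]$ is a finite sequence $D=(a=t_0\le t_1\le\dots\le t_n=b)$; $\mathcal{D}([a,b])$ is the set of all dissections of $[a,b]$. For $p\in[1,\infty)$ and a rectangle $R=[s,t]\times[u,v]$ define, with values in $[0,\infty]$, $$V_p(f;R):=\left(\sup_{(t_i)\in\mathcal{D}([s,t]),\ (t'_j)\in\mathcal{D}([u,v])}\ \sum_{i,j}\bigl|f\bigl([t_i,t_{i+1}]\times[t'_j,t'_{j+1}]\bigr)\bigr|^p\right)^{1/p},$$ $$|f|_{p\text{-var};R}:=\sup_{\Pi\in\mathcal{P}(R)}\left(\sum_{A\in\Pi}|f(A)|^p\right)^{1/p}.$$ The function $f$ has finite controlled $p$-variation if $|f|_{p\text{-var};[0,T]^2}<\infty$. A map $\omega$ from rectangles to $[0,\infty)$ (i.e. $\omega:\Delta_T\times\Delta_T\to[0,\infty)$)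 is super-additive if for every rectangle $R\subset[0,T]^2$ and every partition $\{R_i:1\le i\le n\}\in\mathcal{P}(R)$ one has $\sum_{i=1}^n\omega(R_i)\le\omega(R)$. A 2D control is a map $\omega:\Delta_T\times\Delta_T\to[0,\infty)$ that is continuous (as a function on $\Delta_T\times\Delta_T\subset\mathbb{R}^4$), zero on degenerate rectangles, and super-additive. *)

(* Defs.v *)
(* MathComp-Analysis *)
From HB Require Import structures.
From mathcomp Require Import all_boot all_order all_algebra finmap.
From mathcomp Require Import all_classical all_reals all_analysis.

Set Implicit Arguments.
Unset Strict Implicit.
Unset Printing Implicit Defensive.

Import Order.TTheory GRing.Theory Num.Theory.
Import numFieldNormedType.Exports.

Local Open Scope classical_set_scope.
Local Open Scope ring_scope.

(* The tuple ((a, b), (c, d)) encodes the rectangle [a, b] x [c, d]. Maps on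
   [0, T]^2 or on rectangles are total functions of which only the values on
   [0, T]^2, resp. on [rectangle T], are ever used. *)
Notation rect R := ((R * R) * (R * R))%type.

Definition Delta (R : realType) (T : R) : set (R * R) :=
  [set x | 0 <= x.1 /\ x.1 <= x.2 /\ x.2 <= T].

Definition rectangle (R : realType) (T : R) : set (rect R) :=
  Delta T `*` Delta T.

Definition square (R : realType) (T : R) : rect R := ((0, T), (0, T)).

Definition region (R : realType) (A : rect R) : set (R * R) :=
  `[A.1.1, A.1.2]%classic `*` `[A.2.1, A.2.2]%classic.

Definition degenerate (R : realType) (A : rect R) : Prop :=
  A.1.1 = A.1.2 \/ A.2.1 = A.2.2.

Definition essentially_disjoint (R : realType) (T : R) (A B : rect R) : Prop :=
  region A `&` region B = set0 \/
  exists C : rect R,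
    [/\ rectangle T C, degenerate C & region A `&` region B = region C].

Definition partitions (R : realType) (T : R) (A : rect R) :
    set {fset (rect R)} :=
  [set P | [/\ forall B, B \in P -> rectangle T B,
      forall B C, B \in P -> C \in P -> B <> C -> essentially_disjoint T B C &
      \bigcup_(B in [set` P]) region B = region A]].

Definition increment (R : realType) (f : R * R -> R) (A : rect R) : R :=
  f (A.1.2, A.2.2) - f (A.1.1, A.2.2) - f (A.1.2, A.2.1) + f (A.1.1, A.2.1).

(* [:: t_0; ...; t_n] with a = t_0 <= t_1 <= ... <= t_n = b *)
Definition dissections (R : realType) (a b : R) : set (seq R) :=
  [set D | exists s : seq R, [/\ D = a :: s, path <=%R a s & last a s = b]].

Definition grid_sum (R : realType) (p : R) (f : R * R -> R) (D D' : seq R) : R :=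
  \sum_(i < (size D).-1) \sum_(j < (size D').-1)
    `|increment f ((D`_i, D`_i.+1), (D'`_j, D'`_j.+1))| `^ p.

Definition grid_pvar (R : realType) (p : R) (f : R * R -> R) (A : rect R) :
    \bar R :=
  ((ereal_sup [set x | exists D D' : seq R,
      [/\ dissections A.1.1 A.1.2 D, dissections A.2.1 A.2.2 D' &
          x = (grid_sum p f D D')%:E]]) `^ p^-1)%E.

Definition controlled_pvar (R : realType) (T p : R) (f : R * R -> R)
    (A : rect R) : \bar R :=
  ereal_sup [set ((\sum_(B <- P) `|increment f B| `^ p) `^ p^-1)%:E
            | P in partitions T A].

Definition finite_controlled_pvar (R : realType) (T p : R) (f : R * R -> R) :
    Prop :=
  (controlled_pvar T p f (square T) < +oo)%E.

(* Nonnegativity is part of the definition, as w maps into [0, oo). *)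
Definition super_additive (R : realType) (T : R) (w : rect R -> R) : Prop :=
  (forall A, rectangle T A -> 0 <= w A) /\
  forall A P, rectangle T A -> partitions T A P -> \sum_(B <- P) w B <= w A.

Definition control2D (R : realType) (T : R) (w : rect R -> R) : Prop :=
  [/\ {within rectangle T, continuous w},
      forall A, rectangle T A -> degenerate A -> w A = 0 &
      super_additive T w].

(* Main.v *)
Require Import Defs.
From mathcomp Require Import all_boot all_order all_algebra finmap.
From mathcomp Require Import all_classical all_reals all_analysis.
From mathcomp Require Import lra.
Import Order.TTheory GRing.Theory Num.Theory.
Import numFieldNormedType.Exports.
Local Open Scope classical_set_scope.
Local Open Scope ring_scope.
Set Implicit Arguments.
Unset Strict Implicit.
Unset Printing Implicit Defensive.

(* Every partition of R refines to a grid, the increment over a rectangle being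
   the sum of the increments over its cells: this is (i). For (ii), put
   p' = p + eps, q = p' / (p' - 1) and S = sum_B |f(B)|^p'. By duality
   S = sum_B b_B f(B) with |b_B|^q = |f(B)|^p', and this is the discrete Young
   sum of the step function beta = sum_B b_B 1_B against f over a grid. A
   half-open indicator 1_B has at most four nonzero increments over a grid and at
   most four of them are nonzero on a given cell, so V_q(beta)^q <= C S. As
   1/p + 1/q > 1, a two-dimensional Young inequality yields S <= C V_p(f) S^(1/q).
   It is proved by deleting grid lines one at a time, the cheapest first. The cost
   of deleting a line is a one-dimensional Young sum; deleting points
   simultaneously for all the lines bounds these costs in l^r', where
   r < r' < 1 and 1/r = 1/p + 1/q, so that the cheapest of n of them is
   O(n^(-1/r')), which is summable.

   For (iii), partitions of the members of a partition merge into a partition; the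
   finiteness of the variation on a subrectangle B comes from a 3 x 3 grid with
   central cell B. For (iv), clamping a partition of A onto a subrectangle A' shows
   that w(A') -> w(A) as A' increases to A; with super-additivity, w vanishes on
   thin strips, and by Minkowski's inequality the norm w^(1/p) of a rectangle
   changes by at most the norms of four strips when its sides move. *)

(** * Real powers *)

Section Powers.
Context {R : realType}.
Implicit Types x y t th p q r u v : R.

Lemma powRK x p : 0 <= x -> p != 0 -> (x `^ p) `^ p^-1 = x.
Proof. by move=> x0 p0; rewrite -powRrM divff// powRr1. Qed.

Lemma powRVK x p : 0 <= x -> p != 0 -> (x `^ p^-1) `^ p = x.
Proof. by move=> x0 p0; rewrite -powRrM mulVf// powRr1. Qed.

Lemma le_powR x y r : 0 <= r -> 0 <= x -> x <= y -> x `^ r <= y `^ r.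
Proof.
move=> r0 x0 xy; apply: ge0_ler_powR => //; rewrite nnegrE//.
exact: le_trans x0 xy.
Qed.

Lemma powR_div x y r : 0 <= x -> 0 < y -> (x / y) `^ r = x `^ r / y `^ r.
Proof.
move=> x0 y0; rewrite powRM ?invr_ge0 ?(ltW y0)//; congr (_ * _).
by rewrite -(powR_inv1 (ltW y0)) -powRrM mulN1r powRN.
Qed.

(** The discrete form of integrating x^(-1-th) over a unit interval. After factoring out (k+2)^(-th)
    it is (1 - 1/(k+2))^(-th) >= 1 + th/(k+2), which follows from exp x >= 1 + x and ln (1 + x) <=
    x. *)
Lemma powR_natS_le_diff (th : R) k : 0 < th ->
  k.+2%:R `^ (- (1 + th)) <= (k.+1%:R `^ (- th) - k.+2%:R `^ (- th)) / th.
Proof.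
move=> th0; rewrite ler_pdivlMr//.
have k2 : 0 < k.+2%:R :> R by rewrite ltr0n.
have k1 : 0 < k.+1%:R :> R by rewrite ltr0n.
have -> : k.+2%:R `^ (- (1 + th)) = k.+2%:R^-1 * k.+2%:R `^ (- th) :> R.
  rewrite opprD (@powRD _ _ (-1)); last by rewrite (gt_eqF k2) implybT.
  by rewrite powR_inv1 ?ltW.
have -> : k.+1%:R `^ (- th) =
    k.+2%:R `^ (- th) * (k.+1%:R / k.+2%:R) `^ (- th) :> R.
  by rewrite -powRM ?ltW ?divr_gt0// mulrCA mulfV ?gt_eqF// mulr1.
suff h : 1 + th / k.+2%:R <= (k.+1%:R / k.+2%:R) `^ (- th) :> R.
  have := ler_wpM2l (powR_ge0 k.+2%:R (- th)) h.
  rewrite mulrDr mulr1 => h'; rewrite lerBrDl; apply: le_trans h'.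
  by rewrite mulrCA mulrA mulrAC [_ * th]mulrC mulrA.
rewrite /powR gt_eqF ?divr_gt0//; apply: le_trans (expR_ge1Dx _).
rewrite lerD2l mulNr -mulrN ler_wpM2l ?(ltW th0)//.
have -> : k.+1%:R / k.+2%:R = 1 + (- k.+2%:R^-1) :> R.
  have -> : k.+1%:R = k.+2%:R - 1 :> R by rewrite -(natr1 k.+1) addrK.
  by rewrite mulrBl divff ?mul1r// gt_eqF.
rewrite lerNr; apply: le_ln1Dx; rewrite ltrN2 invf_lt1//.
by rewrite ltr1n.
Qed.

Lemma sum_powR_le m (th : R) : 0 < th ->
  \sum_(i < m) i.+1%:R `^ (- (1 + th)) <= 1 + th^-1.
Proof.
move=> th0.
(* The bound is sharpened by the telescoping remainder so that the induction closes. *)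
suff H n : \sum_(i < n.+1) i.+1%:R `^ (- (1 + th)) <=
    1 + (1 - n.+1%:R `^ (- th)) / th.
  case: m => [|m].
    by rewrite big_ord0 addr_ge0// invr_ge0 ltW.
  apply: le_trans (H m) _; rewrite lerD2l -[leRHS]mul1r.
  by rewrite ler_wpM2r ?invr_ge0 ?(ltW th0)// gerBl powR_ge0.
elim: n => [|n IH]; first by rewrite big_ord1 !powR1 subrr mul0r addr0.
rewrite big_ord_recr/=; apply: le_trans (lerD IH (powR_natS_le_diff n th0)) _.
by rewrite -addrA lerD2l -mulrDl addrA subrK.
Qed.

(** Write z^th = z * z^(th-1): the second factor is nondecreasing in z as th >= 1. *)
Lemma powRD_superadd x y th : 1 <= th -> 0 <= x -> 0 <= y ->
  x `^ th + y `^ th <= (x + y) `^ th.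
Proof.
move=> th1 x0 y0; have th0 : 0 < th by apply: lt_le_trans th1.
have xy0 : 0 <= x + y by exact: addr_ge0.
rewrite -(mulr_powRB1 x0 th0) -(mulr_powRB1 y0 th0) -(mulr_powRB1 xy0 th0).
have th1' : 0 <= th - 1 by rewrite subr_ge0.
rewrite mulrDl; apply: lerD; apply: ler_wpM2l => //; apply: le_powR => //.
  by rewrite lerDl.
by rewrite lerDr.
Qed.

Lemma sum_powR_le_powR_sum (I : Type) (s : seq I) (F : I -> R) th :
  1 <= th -> (forall i, 0 <= F i) ->
  \sum_(i <- s) F i `^ th <= (\sum_(i <- s) F i) `^ th.
Proof.
move=> th1 F0; elim: s => [|a s IH]; first by rewrite big_nil powR_ge0.
rewrite 2!big_cons; apply: (le_trans (lerD (lexx _) IH)).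
by apply: powRD_superadd => //; exact: sumr_ge0.
Qed.

(** Super-additivity of the power 1/th, applied to |x|^th and |y|^th. *)
Lemma powR_normD_le x y th : 0 < th -> th <= 1 ->
  `|x + y| `^ th <= `|x| `^ th + `|y| `^ th.
Proof.
move=> th0 th1; have thN0 : th != 0 by rewrite gt_eqF.
have thV : 1 <= th^-1 by rewrite invf_ge1.
have := powRD_superadd thV (powR_ge0 `|x| th) (powR_ge0 `|y| th).
rewrite (powRK (normr_ge0 x) thN0) (powRK (normr_ge0 y) thN0) => H.
rewrite -[leRHS](@powRVK _ th) ?addr_ge0 ?powR_ge0//.
apply: le_powR; [exact: ltW|exact: normr_ge0|].
exact: le_trans (ler_normD _ _) H.
Qed.

(** With a = x/u and b = y/v, both a^q and b^p are at most their sum M, so a * b <= M^(1/p + 1/q).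
    The scales u and v later normalise two sums separately. *)
Lemma powRM_le_powRD x y p q u v : 0 <= x -> 0 <= y -> 0 < p -> 0 < q ->
  0 < u -> 0 < v ->
  (x * y) `^ (p^-1 + q^-1)^-1 <= (u * v) `^ (p^-1 + q^-1)^-1 *
    (x `^ q / u `^ q + y `^ p / v `^ p).
Proof.
move=> x0 y0 p0 q0 u0 v0.
have s0 : 0 < p^-1 + q^-1 by rewrite addr_gt0 ?invr_gt0.
have uN0 : u != 0 by rewrite gt_eqF.
have vN0 : v != 0 by rewrite gt_eqF.
set r := (_ + _)^-1.
have -> : x * y = (u * v) * ((x / u) * (y / v)).
  by rewrite [RHS]mulrC [RHS]mulrACA (divfK uN0) (divfK vN0).
have uV0 : 0 <= u^-1 by rewrite invr_ge0 ltW.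
have vV0 : 0 <= v^-1 by rewrite invr_ge0 ltW.
rewrite (@powRM _ (u * v)) ?mulr_ge0 ?(ltW u0) ?(ltW v0)//.
apply: ler_wpM2l; first exact: powR_ge0.
rewrite -!powR_div//.
set a := x / u; set b := y / v.
have a0 : 0 <= a by rewrite divr_ge0// ltW.
have b0 : 0 <= b by rewrite divr_ge0// ltW.
set M := a `^ q + b `^ p.
have M0 : 0 <= M by rewrite addr_ge0 ?powR_ge0.
have ab : a * b <= M `^ (p^-1 + q^-1).
  rewrite powRD ?(gt_eqF s0)// [leRHS]mulrC; apply: ler_pM => //.
    rewrite -{1}(@powRK a q) ?(gt_eqF q0)//; apply: le_powR.
    - by rewrite invr_ge0 ltW.
    - exact: powR_ge0.
    - by rewrite lerDl powR_ge0.
  rewrite -{1}(@powRK b p) ?(gt_eqF p0)//; apply: le_powR.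
  - by rewrite invr_ge0 ltW.
  - exact: powR_ge0.
  - by rewrite lerDr powR_ge0.
rewrite -[leRHS](@powRK _ (p^-1 + q^-1)) ?(gt_eqF s0)//.
by apply: le_powR => //; [rewrite invr_ge0 ltW|exact: mulr_ge0].
Qed.

End Powers.

(** * A discrete two-dimensional Young inequality *)

Section Deletion.
Context {R : realType}.

Definition delete (U : Type) l (t : seq U) := take l t ++ drop l.+1 t.

Lemma size_delete (U : Type) l (t : seq U) : (l < size t)%N ->
  size (delete l t) = (size t).-1.
Proof.
move=> lt; rewrite size_cat size_drop size_takel; last exact: ltnW.
have tK := prednK (leq_ltn_trans (leq0n l) lt).
by rewrite -[size t in LHS]tK subSS subnKC// -ltnS tK.
Qed.

Lemma exists_le_mean n (F : nat -> R) M : \sum_(i < n.+1) F i <= M ->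
  exists2 i, (i < n.+1)%N & F i <= M / n.+1%:R.
Proof.
move=> FM; apply/not_exists2P => H.
suff : M < \sum_(i < n.+1) F i by rewrite ltNge FM.
have -> : M = \sum_(i < n.+1) M / n.+1%:R.
  by rewrite sumr_const card_ord -[RHS]mulr_natr divfK// pnatr_eq0.
apply: ltr_sum; first by apply/hasP; exists ord0; rewrite ?mem_index_enum.
by move=> i _; have [/(_ (ltn_ord i))//|/negP] := H i; rewrite -ltNge.
Qed.

(* Of the m correction terms the cheapest one has rho-mass at most M / m, and
   m ^ - (sigma / rho) is summable. *)
Lemma sum_powR_greedy (U : Type) (n : nat) (Phi : seq U -> nat -> R)
    (c : seq U -> nat -> nat -> R) (Q : seq U -> Prop) (rho sigma M : R) :
  0 < rho -> rho < sigma -> sigma <= 1 ->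
  (forall t l, Q t -> (l.+1 < size t)%N -> Q (delete l t)) ->
  (forall t k, (size t <= 1)%N -> Phi t k = 0) ->
  (forall t l k, (l.+1 < size t)%N -> Phi t k = Phi (delete l t) k + c t l k) ->
  (forall t, Q t ->
     \sum_(l < (size t).-1) \sum_(k < n) `|c t l k| `^ rho <= M) ->
  forall t, Q t -> \sum_(k < n) `|Phi t k| `^ sigma <=
    M `^ (sigma / rho) * (1 + (sigma / rho - 1)^-1).
Proof.
move=> rho0 rhosigma sigma1 HQ H0 H1 H2 t Qt.
have sigma0 : 0 < sigma by exact: lt_trans rhosigma.
have th1 : 1 < sigma / rho by rewrite ltr_pdivlMr// mul1r.
have small s : (size s <= 1)%N -> \sum_(k < n) `|Phi s k| `^ sigma = 0.
  by move=> s1; rewrite big1// => k _; rewrite H0// normr0 powR0// gt_eqF.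
suff key m s : Q s -> (size s <= m.+1)%N -> \sum_(k < n) `|Phi s k| `^ sigma <=
    M `^ (sigma / rho) * \sum_(i < m) i.+1%:R `^ (- (1 + (sigma / rho - 1))).
  apply: le_trans (key (size t) t Qt (leqnSn _)) _.
  by rewrite ler_wpM2l ?powR_ge0// sum_powR_le// subr_gt0.
elim: m s => [|m IH] s Qs.
  by move=> s1; rewrite small// mulr_ge0 ?powR_ge0// sumr_ge0// => i _; exact: powR_ge0.
rewrite leq_eqVlt ltnS => /orP[/eqP sm|sm]; last first.
  apply: le_trans (IH s Qs sm) _; rewrite ler_wpM2l ?powR_ge0//.
  by rewrite big_ord_recr/= lerDl powR_ge0.
(* Of the [m.+2] points all but the last may be deleted, so the cheapest of [m.+1] deletions has
   mass at most M / (m+1). *)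
have := H2 s Qs; rewrite sm/= => /(exists_le_mean (F := fun l =>
  \sum_(k < n) `|c s l k| `^ rho))[l lm Hl].
have ls : (l.+1 < size s)%N by rewrite sm.
rewrite big_ord_recr/= mulrDr.
have sd : (size (delete l s) <= m.+1)%N by rewrite size_delete ?sm//; apply: ltnW.
apply: le_trans (lerD (IH _ (HQ _ _ Qs ls) sd) (_ : \sum_(k < n) `|c s l k| `^ sigma <= _)).
  by rewrite -big_split/=; apply: ler_sum => k _; rewrite (H1 s l)// powR_normD_le.
(* Since sigma / rho >= 1, the sigma-mass is at most the power sigma / rho of the rho-mass. *)
apply: (@le_trans _ _ ((\sum_(k < n) `|c s l k| `^ rho) `^ (sigma / rho))).
  have := @sum_powR_le_powR_sum R _ (index_enum 'I_n) (fun k => `|c s l k| `^ rho)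
    (sigma / rho) (ltW th1) (fun=> powR_ge0 _ _).
  apply: le_trans; apply: ler_sum => k _.
  by rewrite /= -powRrM mulrCA divff ?(gt_eqF rho0)// mulr1.
have S0 : 0 <= \sum_(k < n) `|c s l k| `^ rho.
  by apply: sumr_ge0 => k _; exact: powR_ge0.
apply: le_trans (le_powR _ S0 Hl) _; first by rewrite ltW// (lt_trans ltr01).
have M0 : 0 <= M.
  by move: (le_trans S0 Hl); rewrite pmulr_lge0// invr_gt0 ltr0n.
rewrite powRM ?invr_ge0// ler_wpM2l ?powR_ge0//.
by rewrite addrCA subrr addr0 -(powR_inv1 (ler0n _ _)) -powRrM mulN1r.
Qed.

End Deletion.

Section Young.
Context {R : realType}.
Implicit Types (g h : R -> R) (x y : R) (t : seq R).

(** The left-point Riemann-Stieltjes sum of g against h along [x :: t]. The head [x] is kept apart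
    because deletions act on [t] only. *)
Definition young g h x t : R :=
  \sum_(l < size t) g (x :: t)`_l * (h t`_l - h (x :: t)`_l).

Lemma young_cons g h x y t :
  young g h x (y :: t) = g x * (h y - h x) + young g h y t.
Proof. by rewrite /young/= big_ord_recl. Qed.

(** Deleting a point merges two steps: on the second one the value of g at that point is replaced by
    its value at the preceding point. *)
Lemma young_delete g h x t l : (l.+1 < size t)%N ->
  young g h x t = young g h x (delete l t) +
    (g t`_l - g (x :: t)`_l) * (h t`_l.+1 - h t`_l).
Proof.
elim: t x l => [//|y t IH] x [|l] /=.
  case: t {IH} => [//|z t] _; rewrite /delete/= !young_cons/=; lra.
rewrite ltnS => lt; rewrite /delete/= -/(delete l t) !young_cons.
by rewrite (IH y l lt)/= addrA.
Qed.

(* x0 and y0 precede the points of t and t'; as beta vanishes there, deleting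
   points leaves no boundary terms. *)
Lemma young2_bound (p q : R) : 0 < p -> 0 < q -> 1 < p^-1 + q^-1 ->
  exists2 K : R, 0 <= K & forall (beta f : R * R -> R) (x0 y0 u v : R)
      (Q Q' : seq R -> Prop) (t t' : seq R),
    0 < u -> 0 < v ->
    (forall y, beta (x0, y) = 0) -> (forall x, beta (x, y0) = 0) ->
    (forall s l, Q s -> (l.+1 < size s)%N -> Q (delete l s)) ->
    (forall s l, Q' s -> (l.+1 < size s)%N -> Q' (delete l s)) ->
    (forall s s', Q s -> Q' s' ->
       \sum_(k < (size s).-1) \sum_(l < (size s').-1)
         `|increment beta (((x0 :: s)`_k, s`_k), ((y0 :: s')`_l, s'`_l))| `^ q <= u `^ q) ->
    (forall s s', Q s -> Q' s' ->
       \sum_(k < (size s).-1) \sum_(l < (size s').-1)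
         `|increment f ((s`_k, s`_k.+1), (s'`_l, s'`_l.+1))| `^ p <= v `^ p) ->
    Q t -> Q' t' ->
    `|\sum_(l < size t') young (fun x => beta (x, (y0 :: t')`_l))
        (fun x => f (x, t'`_l) - f (x, (y0 :: t')`_l)) x0 t| <= K * (u * v).
Proof.
move=> p0 q0; set s1 := _ + _ => s1_gt1.
have s1_gt0 : 0 < s1 by exact: lt_trans s1_gt1.
(* An exponent strictly between r and 1 leaves room for two greedy deletions: from r to r' in the
   second variable, then from r' to 1 in the first. *)
pose r := s1^-1; pose r' := (1 + r) / 2.
have r_gt0 : 0 < r by rewrite invr_gt0.
have r_lt1 : r < 1 by rewrite invf_lt1.
have rr' : r < r' by rewrite /r'; lra.
have r'_lt1 : r' < 1 by rewrite /r'; lra.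
have r'_gt0 : 0 < r' by exact: lt_trans rr'.
pose Z1 := 1 + (r' / r - 1)^-1; pose Z2 := 1 + (1 / r' - 1)^-1.
have Z1_ge0 : 0 <= Z1.
  by rewrite addr_ge0// invr_ge0 subr_ge0 ler_pdivlMr// mul1r ltW.
have Z2_ge0 : 0 <= Z2.
  by rewrite addr_ge0// invr_ge0 subr_ge0 ler_pdivlMr// mul1r ltW.
exists ((2 `^ (r' / r) * Z1) `^ (1 / r') * Z2); first by rewrite mulr_ge0 ?powR_ge0.
move=> beta f x0 y0 u v Q Q' t t' u0 v0 beta0 beta0' QD Q'D Hbeta Hf Qt Qt'.
have uv0 : 0 <= u * v by rewrite mulr_ge0 ?ltW.
(* Deleting the k-th point of [s] changes the double sum by the one-dimensional Young sum of [G k s]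
   against [H k s]. *)
pose G k (s : seq R) := fun y => beta (s`_k, y) - beta ((x0 :: s)`_k, y).
pose H k (s : seq R) := fun y => f (s`_k.+1, y) - f (s`_k, y).
(* Points of [t'] are deleted for all k at once, which controls all these costs jointly in l^r'. *)
have inner s : Q s -> \sum_(k < (size s).-1)
    `|young (G k s) (H k s) y0 t'| `^ r' <= (2 * (u * v) `^ r) `^ (r' / r) * Z1.
  move=> Qs; apply: (@sum_powR_greedy R R _
    (fun s' k => young (G k s) (H k s) y0 s')
    (fun s' l k => (G k s s'`_l - G k s (y0 :: s')`_l) *
       (H k s s'`_l.+1 - H k s s'`_l)) Q' r r') => //.
  - exact: ltW.
  - move=> [|y [|//]] k _; rewrite /young ?big_ord0 ?big_ord1//=.
    by rewrite /G !beta0' subr0 mul0r.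
  - by move=> s' l k; exact: young_delete.
  - move=> s' Qs'; rewrite exchange_big/=.
    apply: (@le_trans _ _ (\sum_(k < (size s).-1) \sum_(l < (size s').-1)
      (u * v) `^ r *
      (`|increment beta (((x0 :: s)`_k, s`_k), ((y0 :: s')`_l, s'`_l))| `^ q / u `^ q +
        `|increment f ((s`_k, s`_k.+1), (s'`_l, s'`_l.+1))| `^ p / v `^ p))).
      apply: ler_sum => k _; apply: ler_sum => l _.
      apply: le_trans (powRM_le_powRD _ _ p0 q0 u0 v0); rewrite ?normr_ge0//.
      rewrite -normrM le_eqVlt; apply/orP; left; apply/eqP.
      by congr (`| _ * _ | `^ _); rewrite /G /H /increment/=; lra.
    under eq_bigr do rewrite -mulr_sumr.
    rewrite -mulr_sumr [leRHS]mulrC ler_wpM2l ?powR_ge0//.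
    (* After division by u^q and v^p each of the two double sums is at most 1, hence the factor
       2. *)
    under eq_bigr do rewrite big_split -!mulr_suml.
    rewrite big_split -!mulr_suml/= -[2]/(1 + 1) lerD//.
      by rewrite ler_pdivrMr ?powR_gt0// mul1r Hbeta.
    by rewrite ler_pdivrMr ?powR_gt0// mul1r Hf.
(* The outer deletion has a single sum to estimate: the k-index has one value, and the family of
   costs is indexed by the deleted point. *)
have := @sum_powR_greedy R R 1 (fun s _ =>
    \sum_(l < size t') young (fun x => beta (x, (y0 :: t')`_l))
        (fun x => f (x, t'`_l) - f (x, (y0 :: t')`_l)) x0 s)
  (fun s k _ => young (G k s) (H k s) y0 t') Q r' 1
  ((2 * (u * v) `^ r) `^ (r' / r) * Z1) r'_gt0 r'_lt1 (lexx _) QD.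
have h1 s : (size s <= 1)%N -> \sum_(l < size t') young (fun x => beta (x, (y0 :: t')`_l))
        (fun x => f (x, t'`_l) - f (x, (y0 :: t')`_l)) x0 s = 0.
  move: s => [|y [|//]] _; rewrite big1// => l _; rewrite /young ?big_ord0//.
  by rewrite big_ord1/= beta0 mul0r.
move=> /(_ (fun s _ => h1 s)).
have h2 s k : (k.+1 < size s)%N ->
  \sum_(l < size t') young (fun x => beta (x, (y0 :: t')`_l))
        (fun x => f (x, t'`_l) - f (x, (y0 :: t')`_l)) x0 s =
  \sum_(l < size t') young (fun x => beta (x, (y0 :: t')`_l))
        (fun x => f (x, t'`_l) - f (x, (y0 :: t')`_l)) x0 (delete k s) +
  young (G k s) (H k s) y0 t'.
  move=> ks; rewrite [X in _ + X]/young -big_split; apply: eq_bigr => l _ /=.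
  rewrite (young_delete _ _ _ ks); congr (_ + _); rewrite /G /H.
  by congr (_ * _); lra.
move=> /(_ (fun s k _ => h2 s k)).
have h3 s : Q s -> \sum_(k < (size s).-1) \sum_(i < 1)
    `|young (G k s) (H k s) y0 t'| `^ r' <= (2 * (u * v) `^ r) `^ (r' / r) * Z1.
  by move=> Qs; under eq_bigr do rewrite big_ord1; exact: inner.
move=> /(_ h3 t Qt); rewrite big_ord1 powRr1//.
move=> /le_trans; apply; rewrite -/Z2 [leRHS]mulrAC ler_wpM2r//.
(* The exponents r, r'/r and 1/r' multiply to 1, so the bound is linear in u * v. *)
rewrite (@powRM _ 2) ?powR_ge0// mulrAC.
rewrite (@powRM _ _ ((u * v) `^ r `^ _)) ?mulr_ge0 ?powR_ge0//.
rewrite -(powRrM (u * v)) -(powRrM (u * v)) mul1r mulrCA divff ?(gt_eqF r_gt0)//.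
by rewrite mulr1 divff ?(gt_eqF r'_gt0)// powRr1.
Qed.

End Young.

(** * Rectangles and partitions *)

Section Rectangles.
Context {R : realType}.
Implicit Types (T p : R) (f : R * R -> R) (A B C : rect R) (I J : R * R).

(** The interiors meet; an interval reduced to a point overlaps nothing, not even itself. This gives
    a boolean test for essential disjointness. *)
Definition overlapI I J : bool := Num.max I.1 J.1 < Num.min I.2 J.2.

Definition overlap A B : bool := overlapI A.1 B.1 && overlapI A.2 B.2.

Definition subI I J : bool := (J.1 <= I.1) && (I.2 <= J.2).

Definition subrect A B : bool := subI A.1 B.1 && subI A.2 B.2.

Lemma overlapIE I J :
  overlapI I J = [&& I.1 < I.2, I.1 < J.2, J.1 < I.2 & J.1 < J.2].
Proof. by rewrite /overlapI gt_max !lt_min -andbA. Qed.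

Lemma overlapI_sub I I' J J' : subI I' I -> subI J' J ->
  overlapI I' J' -> overlapI I J.
Proof.
move=> /andP[a b] /andP[c d]; rewrite !overlapIE => /and4P[e g h i].
by apply/and4P; split; lra.
Qed.

Lemma overlap_sub A A' B B' : subrect A' A -> subrect B' B ->
  overlap A' B' -> overlap A B.
Proof.
move=> /andP[a b] /andP[c d] /andP[e g].
by rewrite /overlap (overlapI_sub a c e) (overlapI_sub b d g).
Qed.

Lemma regionE A x : region A x <->
  (A.1.1 <= x.1 <= A.1.2) && (A.2.1 <= x.2 <= A.2.2).
Proof. by rewrite /region /= !in_itv; split => [[-> ->]|/andP[-> ->]]. Qed.

Lemma rectangleE T A : rectangle T A <->
  [/\ 0 <= A.1.1, A.1.1 <= A.1.2 & A.1.2 <= T] /\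
  [/\ 0 <= A.2.1, A.2.1 <= A.2.2 & A.2.2 <= T].
Proof.
by split => [[[a [b c]] [d [e g]]]|[[a b c] [d e g]]]; split; split.
Qed.

Lemma subrect_refl A : subrect A A.
Proof. by rewrite /subrect /subI !lexx. Qed.

Lemma subrect_trans A B C : subrect A B -> subrect B C -> subrect A C.
Proof.
move=> /andP[/andP[a b] /andP[c d]] /andP[/andP[e g] /andP[h i]].
by apply/andP; split; apply/andP; split; apply: le_trans; eassumption.
Qed.

Lemma subrect_region A B x : subrect A B -> region A x -> region B x.
Proof.
move=> /andP[/andP[a b] /andP[c d]].
rewrite !regionE => /andP[/andP[e g] /andP[h i]].
by apply/andP; split; apply/andP; split; lra.
Qed.

Lemma region_subrect T A B : rectangle T A -> region A `<=` region B ->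
  subrect A B.
Proof.
move=> /rectangleE[[_ a _] [_ b _]] AB.
have /AB/regionE/andP[/andP[c d] /andP[e g]] : region A (A.1.1, A.2.1).
  by rewrite regionE/= !lexx a b.
have /AB/regionE/andP[/andP[h i] /andP[j k]] : region A (A.1.2, A.2.2).
  by rewrite regionE/= !lexx a b.
by apply/andP; split; apply/andP.
Qed.

(** The intersection is the region of the rectangle [C] with maxima as lower and minima as upper
    ends. If [C] has nonempty interior, its two opposite corners cannot both lie in a degenerate
    rectangle. *)
Lemma essentially_disjointE T A B : rectangle T A -> rectangle T B ->
  essentially_disjoint T A B <-> ~~ overlap A B.
Proof.
move=> /rectangleE[[a1 a2 a3] [a4 a5 a6]] /rectangleE[[b1 b2 b3] [b4 b5 b6]].
pose C : rect R := ((Num.max A.1.1 B.1.1, Num.min A.1.2 B.1.2),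
  (Num.max A.2.1 B.2.1, Num.min A.2.2 B.2.2)).
have CE x : region C x <-> region A x /\ region B x.
  rewrite !regionE/= !ge_max !le_min; split.
    by move=> /andP[/andP[/andP[-> ->] /andP[-> ->]] /andP[/andP[-> ->] /andP[-> ->]]].
  by move=> [/andP[/andP[-> ->] /andP[-> ->]] /andP[/andP[-> ->] /andP[-> ->]]].
split.
  move=> H; apply/negP => /andP[lt1 lt2].
  have C1 : region C (C.1.1, C.2.1).
    by rewrite regionE/= !lexx (ltW lt1) (ltW lt2).
  have C2 : region C (C.1.2, C.2.2).
    by rewrite regionE/= !lexx (ltW lt1) (ltW lt2).
  case: H => [H|[D [_ dD H]]].
    by have : set0 (C.1.1, C.2.1) by rewrite -H; exact/CE.
  have : region D (C.1.1, C.2.1) by rewrite -H; exact/CE.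
  have : region D (C.1.2, C.2.2) by rewrite -H; exact/CE.
  rewrite !regionE/= => /andP[/andP[h1 h2] /andP[h3 h4]].
  move=> /andP[/andP[h5 h6] /andP[h7 h8]].
  rewrite /overlapI in lt1 lt2.
  by case: dD => dD; lra.
move=> nAB.
have [c1|c1] := boolP (C.1.1 <= C.1.2); last first.
  left; apply/seteqP; split => // x /CE/regionE/andP[/andP[u v] _].
  by move: c1; rewrite (le_trans u v).
have [c2|c2] := boolP (C.2.1 <= C.2.2); last first.
  left; apply/seteqP; split => // x /CE/regionE/andP[_ /andP[u v]].
  by move: c2; rewrite (le_trans u v).
right; exists C; split.
- apply/rectangleE; split; split => //=; rewrite ?le_max ?ge_min.
  + by rewrite a1.
  + by rewrite a3.
  + by rewrite a4.
  + by rewrite a6.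
- move: nAB; rewrite /overlap /overlapI negb_and -!leNgt => /orP[h|h].
    by left; apply/eqP; rewrite eq_le h c1.
  by right; apply/eqP; rewrite eq_le h c2.
- by apply/seteqP; split => x; [move/CE|move=> ?; exact/CE].
Qed.

Lemma partitionsP T A P : rectangle T A -> partitions T A P <->
  [/\ forall B, B \in P -> rectangle T B,
      forall B, B \in P -> subrect B A,
      forall B C, B \in P -> C \in P -> B != C -> ~~ overlap B C &
      forall x, region A x -> exists2 B, B \in P & region B x].
Proof.
move=> rA; split => [[h1 h2 h3]|[h1 h2 h3 h4]].
  split => // [B BP|B C BP CP /eqP BC|x].
  - by apply: (region_subrect (h1 _ BP)) => x Bx; rewrite -h3; exists B.
  - by apply/(essentially_disjointE (h1 _ BP) (h1 _ CP)); exact: h2.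
  - by rewrite -h3 => -[B BP Bx]; exists B.
split => // [B C BP CP /eqP BC|].
  by apply/(essentially_disjointE (h1 _ BP) (h1 _ CP)); exact: h3.
apply/seteqP; split => x.
  by move=> [B BP]; apply: subrect_region; exact: h2.
by move/h4 => [B BP Bx]; exists B.
Qed.

Lemma increment_degenerate f A : degenerate A -> increment f A = 0.
Proof. by rewrite /increment => -[] ->; lra. Qed.

Lemma not_overlap_degenerate T A : rectangle T A -> ~~ overlap A A -> degenerate A.
Proof.
move=> /rectangleE[[_ a _] [_ b _]]; rewrite /overlap !overlapIE => h.
have [e|e] := eqVneq A.1.1 A.1.2; first by left.
have [e'|e'] := eqVneq A.2.1 A.2.2; first by right.
by move: h; rewrite !lt_neqAle e e' a b.
Qed.

(** Collisions of h occur only at weight zero, so h is injective once the terms of weight zero are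
    dropped. *)
Lemma sum_comp_le_sum_fset (I K : choiceType) (s : seq I) (h : I -> K)
    (P : {fset K}) (g : K -> R) :
  uniq s -> (forall i, i \in s -> h i \in P) ->
  (forall i j, i \in s -> j \in s -> i != j -> h i = h j -> g (h i) = 0) ->
  (forall k, 0 <= g k) ->
  \sum_(i <- s) g (h i) <= \sum_(k <- P) g k.
Proof.
move=> us hP h0 g0.
rewrite (bigID (fun i => g (h i) != 0))/= [X in _ + X]big1 ?addr0; last first.
  by move=> i; rewrite negbK => /eqP.
rewrite -big_filter -(big_map h predT g)/=.
set s' := [seq i <- s | g (h i) != 0].
have us' : uniq (map h s').
  rewrite map_inj_in_uniq ?filter_uniq// => i j; rewrite !mem_filter.
  move=> /andP[gi si] /andP[gj sj] hij.
  by apply: contraNeq gi => ij; apply/eqP; exact: (h0 i j).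
have s'P k : k \in map h s' -> k \in P.
  by move=> /mapP[i]; rewrite mem_filter => /andP[_ /hP ?] ->.
rewrite [leRHS](bigID (mem (map h s')))/= -[leLHS]addr0.
apply: lerD; last exact: sumr_ge0.
rewrite -[leRHS]big_filter [leRHS](perm_big (map h s'))//=.
apply: uniq_perm => //; first by rewrite filter_uniq// fset_uniq.
by move=> k; rewrite mem_filter/= andb_idr//; exact: s'P.
Qed.

Definition pvar_sum p f (P : {fset (rect R)}) : R :=
  \sum_(B <- P) `|increment f B| `^ p.

(** A finite set forgets repetitions, but no mass is lost: a rectangle listed twice does not overlap
    itself, hence is degenerate and has zero increment. *)
Lemma partition_of_family T p f A (I : choiceType) (s : seq I) (h : I -> rect R) :
  0 < p -> rectangle T A -> uniq s ->
  (forall i, i \in s -> rectangle T (h i) /\ subrect (h i) A) ->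
  (forall i j, i \in s -> j \in s -> i != j -> ~~ overlap (h i) (h j)) ->
  (forall x, region A x -> exists2 i, i \in s & region (h i) x) ->
  exists P, [/\ partitions T A P, forall i, i \in s -> h i \in P &
    \sum_(i <- s) `|increment f (h i)| `^ p <= pvar_sum p f P].
Proof.
move=> p0 rA us rh oh ch; exists (seq_fset tt (map h s)).
have sP i : i \in s -> h i \in seq_fset tt (map h s).
  by move=> si; rewrite seq_fsetE; exact: map_f.
split => //.
  apply/(partitionsP _ rA); split.
  - by move=> B; rewrite seq_fsetE => /mapP[i /rh[? _] ->].
  - by move=> B; rewrite seq_fsetE => /mapP[i /rh[_ ?] ->].
  - move=> B C; rewrite !seq_fsetE => /mapP[i si ->] /mapP[j sj ->] hij.
    by apply: oh => //; apply: contraNneq hij => ->.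
  - by move=> x /ch[i /sP ? ?]; exists (h i).
apply: (@sum_comp_le_sum_fset I _ s h _ (fun B => `|increment f B| `^ p)) => //.
move=> i j si sj ij hij; have := oh _ _ si sj ij; rewrite -hij => od.
  have [ri _] := rh _ si.
  rewrite (increment_degenerate _ (not_overlap_degenerate ri od)).
  by rewrite normr0 powR0// (gt_eqF p0).
Qed.

Definition clampI I (x : R) : R := Num.max I.1 (Num.min I.2 x).

Definition clamp A B : rect R :=
  ((clampI A.1 B.1.1, clampI A.1 B.1.2), (clampI A.2 B.2.1, clampI A.2 B.2.2)).

Lemma clampI_homo I : {homo clampI I : x y / x <= y}.
Proof.
by move=> x y xy; rewrite /clampI ge_max !le_max !le_min !ge_min !lexx xy/= !orbT.
Qed.

Lemma clampI_bounds I x : I.1 <= I.2 -> I.1 <= clampI I x <= I.2.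
Proof.
by move=> I12; rewrite /clampI le_max lexx ge_max ge_min lexx I12.
Qed.

Lemma clampI_id I x : I.1 <= x -> x <= I.2 -> clampI I x = x.
Proof. by move=> ax xb; rewrite /clampI (min_idPr xb) (max_idPr ax). Qed.

Lemma overlapI_clamp I J K : 
  overlapI (clampI I J.1, clampI I J.2) (clampI I K.1, clampI I K.2) ->
  overlapI J K.
Proof.
have H x y : clampI I x < clampI I y -> x < y.
  by apply: contraTT; rewrite -!leNgt; exact: clampI_homo.
by rewrite !overlapIE => /and4P[/= /H -> /H -> /H -> /H ->].
Qed.

Lemma rectangle_sub T A B : rectangle T A -> subrect B A ->
  B.1.1 <= B.1.2 -> B.2.1 <= B.2.2 -> rectangle T B.
Proof.
move=> /rectangleE[[a b c] [d e g]] /andP[/andP[h i] /andP[j k]] l m.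
by apply/rectangleE; split; split => //; lra.
Qed.

Lemma clamp_rectangle T A B : rectangle T A -> rectangle T B ->
  rectangle T (clamp A B) /\ subrect (clamp A B) A.
Proof.
move=> rA rB; have /rectangleE[[a b c] [d e g]] := rA.
have /rectangleE[[_ h _] [_ i _]] := rB.
have s : subrect (clamp A B) A.
  have := (clampI_bounds B.1.1 b, clampI_bounds B.1.2 b).
  have := (clampI_bounds B.2.1 e, clampI_bounds B.2.2 e).
  move=> [/andP[u1 _] /andP[_ u2]] [/andP[u3 _] /andP[_ u4]].
  by apply/andP; split; apply/andP.
by split => //; apply: (rectangle_sub rA s); exact: clampI_homo.
Qed.

(* The clamp onto [A'] is a monotone retraction, so images of essentially
   disjoint rectangles stay essentially disjoint. *)
Lemma partition_clamp T p f A A' P : 0 < p -> rectangle T A -> rectangle T A' ->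
  subrect A' A -> partitions T A P ->
  exists P', partitions T A' P' /\
    \sum_(B <- P) `|increment f (clamp A' B)| `^ p <= pvar_sum p f P'.
Proof.
move=> p0 rA rA' AA' /(partitionsP _ rA)[h1 h2 h3 h4].
have [||||P' [? _ ?]] := @partition_of_family T p f A' _ (P : seq _) (clamp A') p0 rA'.
- exact: fset_uniq.
- by move=> B /h1; exact: clamp_rectangle.
- move=> B C BP CP BC; apply: contra (h3 _ _ BP CP BC) => /andP[u v].
  by rewrite /overlap (overlapI_clamp u) (overlapI_clamp v).
(* A point of [A'] is fixed by the clamp, so it stays in the image of any rectangle that contains
   it. *)
- move=> x A'x; have [B BP Bx] := h4 _ (subrect_region AA' A'x); exists B => //.
  move: A'x Bx; rewrite !regionE => /andP[/andP[a b] /andP[c d]].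
  move=> /andP[/andP[e g] /andP[h i]]; rewrite -(clampI_id a b) -(clampI_id c d) /=.
  by rewrite !clampI_homo.
- by exists P'.
Qed.

Lemma partition_refine T p f A P (Q : rect R -> {fset (rect R)}) : 0 < p ->
  rectangle T A -> partitions T A P ->
  (forall B, B \in P -> partitions T B (Q B)) ->
  exists P', partitions T A P' /\
    \sum_(B <- P) pvar_sum p f (Q B) <= pvar_sum p f P'.
Proof.
move=> p0 rA /(partitionsP _ rA)[h1 h2 h3 h4] hQ.
have {}hQ B (BP : B \in P) := (partitionsP _ (h1 B BP)).1 (hQ B BP).
(* Indexing by pairs allows a degenerate rectangle to belong to several of the [Q B]. *)
pose s := [seq (B, C) | B <- P, C <- Q B].
have sP B C : (B, C) \in s = (B \in P) && (C \in Q B).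
  apply/allpairsPdep/andP => [[B' [C' [? ? [-> ->]]]]//|[? ?]].
  by exists B, C.
have [||||P' [? _ H]] := @partition_of_family T p f A _ s snd p0 rA.
- apply: allpairs_uniq_dep => //; first exact: fset_uniq.
    by move=> B _; exact: fset_uniq.
  by move=> [? ?] [? ?] _ _ /= [-> ->].
- move=> [B C]; rewrite sP => /andP[BP CB]; have [k1 k2 _ _] := hQ B BP.
  by split; [exact: k1|apply: subrect_trans (h2 _ BP); exact: k2].
- move=> [B C] [B' C']; rewrite !sP /= => /andP[BP CB] /andP[BP' CB'].
  have [_ k2 k3 _] := hQ B BP; have [_ k2' _ _] := hQ B' BP'.
  have [eB|nB _] := eqVneq B B'.
    by subst B'; rewrite xpair_eqE eqxx/= => CC; exact: k3.
  by apply: contra (h3 _ _ BP BP' nB); apply: overlap_sub; [exact: k2|exact: k2'].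
- move=> x /h4[B BP Bx]; have [_ _ _ /(_ x Bx)[C CB Cx]] := hQ B BP.
  by exists (B, C); rewrite // sP BP.
- by exists P'; split => //; move: H; rewrite big_allpairs_dep.
Qed.

Lemma partition_set1 T A : rectangle T A -> partitions T A [fset A]%fset.
Proof.
move=> rA; apply/(partitionsP _ rA); split => [B|B|B C|x Ax].
- by rewrite inE => /eqP ->.
- by rewrite inE => /eqP ->; exact: subrect_refl.
- by rewrite !inE => /eqP -> /eqP ->; rewrite eqxx.
- by exists A; rewrite ?inE.
Qed.

Definition cell (D D' : seq R) (i : nat * nat) : rect R :=
  ((D`_i.1, D`_i.1.+1), (D'`_i.2, D'`_i.2.+1)).

Lemma dissection_cover (a : R) s x : s != [::] -> a <= x -> x <= last a s ->
  exists2 i, (i < size s)%N & (a :: s)`_i <= x <= s`_i.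
Proof.
elim: s a => [//|y s IH] a _ ax /=.
have [xy _|yx] := leP x y; first by exists 0%N; rewrite //= ax.
case: s IH => [_ /= xy|z s IH xl]; first by move: yx; rewrite ltNge xy.
by have [//|i ? ?] := IH y _ (ltW yx) xl; exists i.+1.
Qed.

Lemma dissection_nth (a b : R) D : dissections a b D ->
  forall i j, (i <= j)%N -> (j < size D)%N -> a <= D`_i /\ D`_i <= D`_j <= b.
Proof.
move=> [s [-> pa <-]] i j ij js.
have so := sorted_leq_nth le_trans lexx 0 (pa : sorted <=%R (a :: s)).
have is' : (i < size (a :: s))%N := leq_ltn_trans ij js.
split; first by have := so 0%N i isT is' isT; rewrite /=.
rewrite so//= (last_nth 0).
by have := so j (size s) js (ltnSn _); apply; rewrite -ltnS.
Qed.

(** Both dissections must have a step, as a one-point dissection has no cells and covers nothing.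
    Repeated points only produce degenerate cells. *)
Lemma partition_grid T p f A D D' : 0 < p -> rectangle T A ->
  dissections A.1.1 A.1.2 D -> dissections A.2.1 A.2.2 D' ->
  (1 < size D)%N -> (1 < size D')%N ->
  exists P, [/\ partitions T A P,
    forall i j, (i < (size D).-1)%N -> (j < (size D').-1)%N -> cell D D' (i, j) \in P &
    grid_sum p f D D' <= pvar_sum p f P].
Proof.
move=> p0 rA dD dD' sD sD'.
pose s := [seq (i, j) | i <- iota 0 (size D).-1, j <- iota 0 (size D').-1].
have sP i j : (i, j) \in s = (i < (size D).-1)%N && (j < (size D').-1)%N.
  apply/allpairsP/andP => [[[i' j'] /=]|[? ?]].
    by rewrite !mem_iota/= !add0n => -[? ? [-> ->]].
  by exists (i, j); rewrite !mem_iota/= !add0n.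
have ltD n (E : seq R) : (n < (size E).-1)%N -> (n.+1 < size E)%N.
  by case: E.
have HD := dissection_nth dD; have HD' := dissection_nth dD'.
have [||||P [? sPP H]] := @partition_of_family T p f A _ s (cell D D') p0 rA.
- apply: allpairs_uniq; [exact: iota_uniq|exact: iota_uniq|].
  by move=> [? ?] [? ?] _ _ /= [-> ->].
- move=> [i j]; rewrite sP => /andP[/ltD iD /ltD jD].
  have [a /andP[b c]] := HD _ _ (leqnSn i) iD.
  have [d /andP[e g]] := HD' _ _ (leqnSn j) jD.
  have sc : subrect (cell D D' (i, j)) A by rewrite /subrect /subI/= a c d g.
  by split => //; exact: (rectangle_sub rA sc).
- have key (E : seq R) a b i i' : dissections a b E -> (i < i')%N -> (i' < (size E).-1)%N ->
      ~~ overlapI (E`_i, E`_i.+1) (E`_i', E`_i'.+1).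
    move=> /dissection_nth dE ii' /ltD/ltnW i'E.
    have [_ /andP[h _]] := dE _ _ ii' i'E.
    by rewrite overlapIE/= [E`_i' < _]ltNge h/= !andbF.
  have overlapIC I J : overlapI I J = overlapI J I.
    by rewrite /overlapI maxC minC.
  move=> [i j] [i' j']; rewrite !sP => /andP[iD jD] /andP[i'D j'D] ne.
  rewrite /overlap negb_and /=.
  have [h|h|h] := ltngtP i i'; first by rewrite (key _ _ _ _ _ dD h).
    by rewrite overlapIC (key _ _ _ _ _ dD h).
  have [k|k|k] := ltngtP j j'; first by apply/orP; right; exact: (key _ _ _ _ _ dD' k).
    by apply/orP; right; rewrite overlapIC; exact: (key _ _ _ _ _ dD' k).
  by move: ne; rewrite h k eqxx.
- have cov (E : seq R) a b y : dissections a b E -> (1 < size E)%N -> a <= y <= b ->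
      exists2 i, (i < (size E).-1)%N & E`_i <= y <= E`_i.+1.
    move=> [t [-> _ <-]] st /andP[ay yb].
    by apply: dissection_cover => //; move: st; case: (t).
  move=> x /regionE/andP[/(cov _ _ _ _ dD sD)[i iD hi]].
  move=> /(cov _ _ _ _ dD' sD')[j jD hj].
  by exists (i, j); rewrite ?sP ?iD// regionE/= hi.
- exists P; split => //; first by move=> i j iD jD; apply: sPP; rewrite sP iD.
  apply: le_trans H; rewrite big_allpairs_dep /grid_sum.
  have iotaE n (F : nat -> R) : \sum_(i < n) F i = \sum_(i <- iota 0 n) F i.
    by rewrite -(big_mkord xpredT F) /index_iota subn0.
  rewrite (iotaE _ (fun i => \sum_(j < (size D').-1)
    `|increment f (cell D D' (i, val j))| `^ p)).
  apply: ler_sum => i _.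
  by rewrite (iotaE _ (fun j => `|increment f (cell D D' (i, j))| `^ p)).
Qed.

End Rectangles.

(** * Refining a partition into a grid *)

Section GridRefinement.
Context {R : realType}.
Implicit Types (T p : R) (f : R * R -> R) (A B C : rect R).

Lemma poweR_le_mono (x y : \bar R) (r : R) : 0 <= r ->
  (0 <= x)%E -> (x <= y)%E -> (x `^ r <= y `^ r)%E.
Proof.
move=> r0 x0 xy; apply: gt0_ler_poweR => //; rewrite in_itv/= ?x0 ?leey//.
by rewrite (le_trans x0 xy).
Qed.

Lemma poweRK (x : \bar R) (r : R) : (0 <= x)%E -> r != 0 -> ((x `^ r) `^ r^-1 = x)%E.
Proof. by move=> x0 r0; rewrite -poweRrM divff// poweRe1. Qed.

Lemma poweRVK (x : \bar R) (r : R) : (0 <= x)%E -> r != 0 -> ((x `^ r^-1) `^ r = x)%E.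
Proof. by move=> x0 r0; rewrite -poweRrM mulVf// poweRe1. Qed.

Lemma ereal_sup_poweR_le (S : set (\bar R)) (r : R) (y : \bar R) : 0 < r ->
  (forall x, S x -> (0 <= x)%E) -> (0 <= y)%E ->
  (forall x, S x -> (x `^ r <= y)%E) -> ((ereal_sup S) `^ r <= y)%E.
Proof.
(* The supremum of the empty set is -oo, whose power with exponent r > 0 is 0. *)
move=> r0 S0 y0 Sy; have [[x Sx]|/set0P/negP/negPn/eqP ->] := pselect (S !=set0); last first.
  by rewrite ereal_sup0 poweRNyr ?(gt_eqF r0).
have rN0 : r != 0 by rewrite gt_eqF.
rewrite -[leRHS](poweRVK y0 rN0); apply: poweR_le_mono; first exact: ltW.
  by apply: le_ereal_sup_tmp; exists x; last exact: S0.
apply: ge_ereal_sup => z Sz; rewrite -[leLHS](poweRK (S0 z Sz) rN0).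
apply: poweR_le_mono; [by rewrite invr_ge0 ltW|exact: poweR_ge0|exact: Sy].
Qed.

Lemma pvar_sum_ge0 p f P : 0 <= pvar_sum p f P.
Proof. by apply: sumr_ge0 => B _; exact: powR_ge0. Qed.

Lemma grid_sum_ge0 p f D D' : 0 <= grid_sum p f D D'.
Proof. by apply: sumr_ge0 => i _; apply: sumr_ge0 => j _; exact: powR_ge0. Qed.

Lemma controlled_pvar_ge T p f A P : partitions T A P ->
  ((pvar_sum p f P `^ p^-1)%:E <= controlled_pvar T p f A)%E.
Proof. by move=> PA; apply: ereal_sup_ubound; exists P. Qed.

Lemma controlled_pvar_ge0 T p f A : rectangle T A ->
  (0 <= controlled_pvar T p f A)%E.
Proof.
move=> rA; apply: le_trans (controlled_pvar_ge p f (partition_set1 rA)).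
by rewrite lee_fin powR_ge0.
Qed.

Lemma controlled_pvar_poweR T p f A : 0 < p -> rectangle T A ->
  (controlled_pvar T p f A `^ p =
   ereal_sup [set (pvar_sum p f P)%:E | P in partitions T A])%E.
Proof.
move=> p0 rA; have pN0 : p != 0 by rewrite gt_eqF.
apply/eqP; rewrite eq_le; apply/andP; split.
  apply: ereal_sup_poweR_le => // [_ [P _ <-]||_ [P PA <-]].
  - by rewrite lee_fin powR_ge0.
  - apply: le_ereal_sup_tmp; exists (pvar_sum p f [fset A]%fset)%:E.
      by exists [fset A]%fset => //; exact: partition_set1.
    by rewrite lee_fin pvar_sum_ge0.
  - rewrite poweR_EFin (powRVK (pvar_sum_ge0 p f P) pN0).
    by apply: ereal_sup_ubound; exists P.
apply: ge_ereal_sup => _ [P PA <-].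
rewrite -(powRVK (pvar_sum_ge0 p f P) pN0) -poweR_EFin.
apply: poweR_le_mono; [exact: ltW|by rewrite lee_fin powR_ge0|].
exact: controlled_pvar_ge.
Qed.

Lemma grid_pvar_ge p f A D D' : 0 < p -> dissections A.1.1 A.1.2 D ->
  dissections A.2.1 A.2.2 D' ->
  ((grid_sum p f D D' `^ p^-1)%:E <= grid_pvar p f A)%E.
Proof.
move=> p0 dD dD'; rewrite -poweR_EFin; apply: poweR_le_mono.
- by rewrite invr_ge0 ltW.
- by rewrite lee_fin grid_sum_ge0.
- by apply: ereal_sup_ubound; exists D, D'.
Qed.

Lemma grid_pvar_le_controlled_pvar T p f A : 0 < p -> rectangle T A ->
  (grid_pvar p f A <= controlled_pvar T p f A)%E.
Proof.
move=> p0 rA; apply: ereal_sup_poweR_le.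
- by rewrite invr_gt0.
- by move=> _ [D [D' [_ _ ->]]]; rewrite lee_fin grid_sum_ge0.
- exact: controlled_pvar_ge0.
move=> _ [D [D' [dD dD' ->]]]; rewrite poweR_EFin.
have z0 : (0 `^ p^-1)%:E = 0 :> \bar R by rewrite powR0// invr_eq0 (gt_eqF p0).
(* A one-point dissection yields an empty sum instead of a partition. *)
have [sD|sD] := leqP (size D) 1.
  rewrite /grid_sum; have -> : (size D).-1 = 0%N by case: (size D) sD => [|[]].
  by rewrite big_ord0 z0; exact: controlled_pvar_ge0.
have [sD'|sD'] := leqP (size D') 1.
  rewrite /grid_sum; have -> : (size D').-1 = 0%N by case: (size D') sD' => [|[]].
  by rewrite big1 ?z0 ?controlled_pvar_ge0// => i _; rewrite big_ord0.
have [P [PA _ H]] := @partition_grid R T p f A D D' p0 rA dD dD' sD sD'.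
apply: le_trans (controlled_pvar_ge p f PA); rewrite lee_fin.
by apply: le_powR => //; [rewrite invr_ge0 ltW|exact: grid_sum_ge0].
Qed.

(** Dissections may repeat points, so it suffices to sort [a], [b] and [E] together. *)
Lemma dissection_through (a b : R) (E : seq R) : a <= b ->
  (forall x, x \in E -> a <= x <= b) ->
  exists2 D, dissections a b D & {subset E <= D}.
Proof.
move=> ab hE; pose D := sort <=%R [:: a, b & E].
have mD x : (x \in D) = [|| x == a, x == b | x \in E] by rewrite mem_sort !inE.
exists D; last by move=> x xE; rewrite mD xE !orbT.
have bD x : x \in D -> a <= x <= b.
  by rewrite mD => /or3P[/eqP ->|/eqP ->|/hE//]; rewrite lexx ab.
have aD : a \in D by rewrite mD eqxx.
have bbD : b \in D by rewrite mD eqxx orbT.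
have : sorted <=%R D by exact: sort_le_sorted.
case: D aD bbD bD {mD} => [//|x s] aD bbD bD pxs.
have hx := @dissection_nth R x (last x s) (x :: s) (ex_intro _ s (And3 erefl pxs erefl)).
have bnd y : y \in x :: s -> x <= y <= last x s.
  move=> ys; have ys' : (index y (x :: s) < size (x :: s))%N by rewrite index_mem.
  by have := hx _ _ (leqnn _) ys'; rewrite nth_index// => -[->] /andP[_ ->].
have xa : x = a.
  apply/eqP; rewrite eq_le; have /andP[-> _] := bnd _ aD.
  by have /andP[-> _] := bD _ (mem_head x s).
have lb : last x s = b.
  apply/eqP; rewrite eq_le; have /andP[_ ->] := bnd _ bbD.
  by have /andP[_ ->] := bD _ (mem_last x s).
by exists s; split => //; rewrite -xa.
Qed.

Lemma path_le_cst (d : R) s x i : path <=%R d s -> x <= d -> (i <= size s)%N ->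
  x <= (d :: s)`_i.
Proof.
move=> pds xd; case: i => [//|i] /= iS; apply: le_trans xd _.
by have /(all_nthP 0) := order_path_min le_trans pds; apply.
Qed.

(** Only the steps that start at or after x survive, and they telescope; steps between equal points
    have zero increment, so repetitions of x are harmless. *)
Lemma sum_step_increments (h : R -> R) (d : R) s x : path <=%R d s -> x \in d :: s ->
  \sum_(i < size s) (x <= (d :: s)`_i)%R%:R * (h s`_i - h (d :: s)`_i) =
    h (last d s) - h x.
Proof.
elim: s d x => [|y s IH] d x pds.
  by rewrite inE => /eqP ->; rewrite big_ord0 subrr.
have /andP[dy pys] : (d <= y) && path <=%R y s by [].
rewrite big_ord_recl/= inE => /orP[/eqP ->|xs].
  rewrite lexx mul1r; have := IH y y pys (mem_head _ _).
  rewrite (_ : \sum_(i < size s) _ = \sum_(i < size s) (d <= (y :: s)`_i)%R%:R *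
      (h s`_i - h (y :: s)`_i)); last first.
    apply: eq_bigr => i _; have iS : (i <= size s)%N := ltnW (ltn_ord i).
    by rewrite (path_le_cst pys (lexx y) iS) (path_le_cst pys dy iS).
  by move=> ->; lra.
rewrite IH//; have yx : y <= x.
  move: xs; rewrite inE => /orP[/eqP ->//|].
  by apply/allP; exact: order_path_min le_trans pys.
have [xd|] := boolP (x <= d); last by rewrite mul0r add0r.
have -> : y = d by apply/eqP; rewrite eq_le dy (le_trans yx xd).
by rewrite subrr mulr0 add0r.
Qed.

(** Half-open, so that non-overlapping rectangles have disjoint indicators. *)
Definition indic B (z : R * R) : R :=
  ((B.1.1 <= z.1 < B.1.2) && (B.2.1 <= z.2 < B.2.2))%R%:R.

Lemma indicI (a b t : R) : a <= b ->
  (a <= t < b)%R%:R = (a <= t)%R%:R - (b <= t)%R%:R :> R.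
Proof.
move=> ab; rewrite ltNge; have [bt|] := leP b t; last by rewrite andbT subr0.
by rewrite (le_trans ab bt) subrr.
Qed.

Lemma sum_indic_increments (h : R -> R) (a b x y : R) D : dissections a b D ->
  x <= y -> x \in D -> y \in D ->
  \sum_(i < (size D).-1) (x <= D`_i < y)%R%:R * (h D`_i.+1 - h D`_i) = h y - h x.
Proof.
move=> [s [-> pas _]] xy xD yD /=.
under eq_bigr do rewrite (indicI _ xy) mulrBl.
by rewrite sumrB !sum_step_increments//; lra.
Qed.

(** The one-dimensional telescoping in each variable in turn: the lower left corner of a cell
    decides whether the cell belongs to [B]. *)
Lemma increment_indic f (a b c d : R) B D D' : dissections a b D -> dissections c d D' ->
  B.1.1 <= B.1.2 -> B.2.1 <= B.2.2 ->
  B.1.1 \in D -> B.1.2 \in D -> B.2.1 \in D' -> B.2.2 \in D' ->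
  increment f B = \sum_(i < (size D).-1) \sum_(j < (size D').-1)
    indic B (D`_i, D'`_j) * increment f (cell D D' (i : nat, j : nat)).
Proof.
move=> dD dD' B1 B2 D1 D2 D3 D4.
have -> : increment f B = (f (B.1.2, B.2.2) - f (B.1.2, B.2.1)) -
    (f (B.1.1, B.2.2) - f (B.1.1, B.2.1)) by rewrite /increment; lra.
rewrite -(sum_indic_increments (fun x => f (x, B.2.2) - f (x, B.2.1)) dD B1 D1 D2).
apply: eq_bigr => i _.
rewrite -(sum_indic_increments (fun y => f (D`_i.+1, y)) dD' B2 D3 D4).
rewrite -(sum_indic_increments (fun y => f (D`_i, y)) dD' B2 D3 D4).
rewrite -sumrB mulr_sumr; apply: eq_bigr => j _.
rewrite -mulrBr mulrA /indic -natrM mulnb; congr (_ * _).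
by rewrite /increment/=; lra.
Qed.

Lemma indic_overlap B C z : indic B z != 0 -> indic C z != 0 -> overlap B C.
Proof.
rewrite /indic !pnatr_eq0 !eqb0 !negbK.
move=> /andP[/andP[a b] /andP[c d]] /andP[/andP[e g] /andP[h i]].
rewrite /overlap !overlapIE (le_lt_trans a b) (le_lt_trans a g) (le_lt_trans e b).
by rewrite (le_lt_trans e g) (le_lt_trans c d) (le_lt_trans c i) (le_lt_trans h d)
  (le_lt_trans h i).
Qed.

Lemma indic_ge0 B z : 0 <= indic B z.
Proof. exact: ler0n. Qed.

Lemma sum_indic_le1 (P : {fset (rect R)}) z :
  (forall B C, B \in P -> C \in P -> B != C -> ~~ overlap B C) ->
  \sum_(B <- P) indic B z <= 1.
Proof.
move=> hP; have [[B BP Bz]|nB] := pselect (exists2 B, B \in P & indic B z != 0).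
  rewrite (bigD1_seq B) ?fset_uniq//= big1_seq ?addr0; first by rewrite lern1 leq_b1.
  move=> C /andP[CB CP]; apply/eqP; apply: contraNT (hP _ _ CP BP CB) => Cz.
  exact: indic_overlap Cz Bz.
rewrite big1_seq// => B /= BP; apply/eqP/negPn/negP => Bz.
by apply: nB; exists B.
Qed.

Lemma partition_dissections T A P : rectangle T A -> partitions T A P ->
  exists D D', [/\ dissections A.1.1 A.1.2 D, dissections A.2.1 A.2.2 D' &
    forall f B, B \in P -> increment f B =
      \sum_(i < (size D).-1) \sum_(j < (size D').-1)
        indic B (D`_i, D'`_j) * increment f (cell D D' (i : nat, j : nat))].
Proof.
move=> rA /(partitionsP _ rA)[h1 h2 _ _].
have /rectangleE[[_ a _] [_ b _]] := rA.
have [|D dD sD] := @dissection_through A.1.1 A.1.2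
  ([seq B.1.1 | B : rect R <- P] ++ [seq B.1.2 | B : rect R <- P]) a.
  move=> x; rewrite mem_cat => /orP[] /mapP[B BP ->].
    have /andP[/andP[c d] _] := h2 _ BP.
    by have /rectangleE[[_ e _] _] := h1 _ BP; rewrite c (le_trans e d).
  have /andP[/andP[c d] _] := h2 _ BP.
  by have /rectangleE[[_ e _] _] := h1 _ BP; rewrite d (le_trans c e).
have [|D' dD' sD'] := @dissection_through A.2.1 A.2.2
  ([seq B.2.1 | B : rect R <- P] ++ [seq B.2.2 | B : rect R <- P]) b.
  move=> x; rewrite mem_cat => /orP[] /mapP[B BP ->].
    have /andP[_ /andP[c d]] := h2 _ BP.
    by have /rectangleE[_ [_ e _]] := h1 _ BP; rewrite c (le_trans e d).
  have /andP[_ /andP[c d]] := h2 _ BP.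
  by have /rectangleE[_ [_ e _]] := h1 _ BP; rewrite d (le_trans c e).
exists D, D'; split => // f B BP.
have /rectangleE[[_ c _] [_ d _]] := h1 _ BP.
apply: (increment_indic f dD dD' c d).
- by apply: sD; rewrite mem_cat (map_f (fun B : rect R => B.1.1)).
- by apply: sD; rewrite mem_cat (map_f (fun B : rect R => B.1.2)) ?orbT.
- by apply: sD'; rewrite mem_cat (map_f (fun B : rect R => B.2.1)).
- by apply: sD'; rewrite mem_cat (map_f (fun B : rect R => B.2.2)) ?orbT.
Qed.

Lemma controlled_1var T f A : rectangle T A ->
  controlled_pvar T 1 f A = grid_pvar 1 f A.
Proof.
move=> rA; apply/eqP; rewrite eq_le grid_pvar_le_controlled_pvar// andbT.
apply: ge_ereal_sup => _ [P PA <-].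
have [D [D' [dD dD' H]]] := partition_dissections rA PA.
apply: le_trans (grid_pvar_ge f ltr01 dD dD'); rewrite lee_fin.
apply: le_powR; [by rewrite invr1|exact: pvar_sum_ge0|].
have [_ _ dis _] := (partitionsP P rA).1 PA.
rewrite big_seq; under eq_bigr => B BP do rewrite (H f B BP) powRr1//.
apply: (@le_trans _ _ (\sum_(B <- P | B \in P) \sum_(i < (size D).-1)
    \sum_(j < (size D').-1) indic B (D`_i, D'`_j) *
      `|increment f (cell D D' (i : nat, j : nat))|)).
  apply: ler_sum => B _; apply: le_trans (ler_norm_sum _ _ _) _.
  apply: ler_sum => i _; apply: le_trans (ler_norm_sum _ _ _) _.
  by apply: ler_sum => j _; rewrite normrM (ger0_norm (indic_ge0 _ _)).
(* Each cell now carries the total weight of the indicators at its lower left corner, which is at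
   most 1. *)
rewrite -big_seq exchange_big/=; apply: ler_sum => i _.
rewrite exchange_big/=; apply: ler_sum => j _.
rewrite -mulr_suml powRr1// ler_piMl//; exact: sum_indic_le1.
Qed.

End GridRefinement.

(** * Grid variation bounds controlled variation *)

Section GridBound.
Context {R : realType}.
Implicit Types (T p q : R) (f : R * R -> R) (A B : rect R).

(** Deletions may remove the left endpoint, so the points that remain form only the tail of a
    dissection. *)
Lemma grid_sum_tail p f (a c : R) s s' :
  grid_sum p f s s' <= grid_sum p f (a :: s) (c :: s').
Proof.
have ge0 n (F : nat -> R) : (forall i, 0 <= F i) -> 0 <= \sum_(i < n) F i.
  by move=> F0; exact: sumr_ge0.
case: s => [|x s]; first by rewrite {1}/grid_sum big_ord0 grid_sum_ge0.
rewrite /grid_sum/= [leRHS]big_ord_recl -[leLHS]add0r; apply: lerD.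
  by apply: sumr_ge0 => j _; exact: powR_ge0.
apply: ler_sum => i _.
case: s' => [|y s']; first by rewrite big_ord0 sumr_ge0.
rewrite /= [leRHS]big_ord_recl -[leLHS]add0r; apply: lerD; first exact: powR_ge0.
by apply: ler_sum => j _.
Qed.

Lemma step_variation (d x : R) s : path <=%R d s ->
  \sum_(k < size s) `|(x <= s`_k)%R%:R - (x <= (d :: s)`_k)%R%:R| =
    (x <= last d s)%R%:R - (x <= d)%R%:R :> R.
Proof.
elim: s d => [|y s IH] d /=; first by rewrite big_ord0 subrr.
move=> /andP[dy pys]; rewrite big_ord_recl/= IH// ger0_norm; first lra.
rewrite subr_ge0 ler_nat; case: (leP x d) => // xd.
by rewrite (le_trans xd dy).
Qed.

(** The indicator of [a, b) is the difference of two monotone steps, each of variation at most 1. *)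
Lemma indic_variation (a b d : R) s : path <=%R d s -> a <= b ->
  \sum_(k < (size s).-1)
    `|(a <= s`_k < b)%R%:R - (a <= (d :: s)`_k < b)%R%:R| <= 2 :> R.
Proof.
move=> ps ab.
pose F k : R := `|(a <= s`_k < b)%R%:R - (a <= (d :: s)`_k < b)%R%:R|.
apply: (@le_trans _ _ (\sum_(k < size s) F k)).
  case: (size s) => [|n]; first by rewrite !big_ord0.
  by rewrite [leRHS]big_ord_recr/= lerDl; exact: normr_ge0.
have st x : \sum_(k < size s) `|(x <= s`_k)%R%:R - (x <= (d :: s)`_k)%R%:R| <= 1 :> R.
  rewrite step_variation//; apply: le_trans (_ : _ <= (x <= last d s)%R%:R) _.
    by rewrite gerBl ler0n.
  by rewrite lern1 leq_b1.
have := lerD (st a) (st b); rewrite -big_split/=; apply: le_trans.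
apply: ler_sum => k _; rewrite /F !indicI//.
apply: le_trans (ler_normB _ _); rewrite le_eqVlt; apply/orP; left; apply/eqP.
by congr (`|_|); lra.
Qed.

Lemma increment_indicE B x x' y y' :
  increment (indic B) ((x, x'), (y, y')) =
  ((B.1.1 <= x' < B.1.2)%R%:R - (B.1.1 <= x < B.1.2)%R%:R) *
  ((B.2.1 <= y' < B.2.2)%R%:R - (B.2.1 <= y < B.2.2)%R%:R).
Proof. by rewrite /increment /indic/= -!mulnb !natrM; lra. Qed.

Lemma increment_indic_norm B C :
  `|increment (indic B) C| = 0 \/ `|increment (indic B) C| = 1.
Proof.
have norm_sub (b c : bool) : `|b%:R - c%:R : R| = 0 \/ `|b%:R - c%:R : R| = 1.
  case: b; case: c; rewrite ?subrr ?subr0 ?sub0r ?normrN ?normr0 ?normr1; by [left|right].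
case: C => [[x x'] [y y']]; rewrite increment_indicE normrM.
case: (norm_sub (B.1.1 <= x' < B.1.2) (B.1.1 <= x < B.1.2)) => ->.
  by left; rewrite mul0r.
by rewrite mul1r; exact: norm_sub.
Qed.

(** Each of the four corners of [C] lies in the support of at most one indicator. *)
Lemma sum_increment_indic_le4 (P : {fset (rect R)}) C :
  (forall B B', B \in P -> B' \in P -> B != B' -> ~~ overlap B B') ->
  \sum_(B <- P) `|increment (indic B) C| <= 4.
Proof.
move=> hP; have h z := sum_indic_le1 z hP.
apply: (@le_trans _ _ (\sum_(B <- P) (indic B (C.1.2, C.2.2) + indic B (C.1.1, C.2.2) +
  indic B (C.1.2, C.2.1) + indic B (C.1.1, C.2.1)))).
  apply: ler_sum => B _; rewrite /increment.
  have i1 := indic_ge0 B (C.1.2, C.2.2); have i2 := indic_ge0 B (C.1.1, C.2.2).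
  have i3 := indic_ge0 B (C.1.2, C.2.1); have i4 := indic_ge0 B (C.1.1, C.2.1).
  by rewrite ler_norml; apply/andP; split; lra.
rewrite !big_split/=.
have h1 := h (C.1.2, C.2.2); have h2 := h (C.1.1, C.2.2).
have h3 := h (C.1.2, C.2.1); have h4 := h (C.1.1, C.2.1); lra.
Qed.

(** At most c of the e_i are nonzero, and for those |b_i| is at most M^(1/q), where M is the sum on
    the right. *)
Lemma powR_norm_sum_le (I : eqType) (s : seq I) (b e : I -> R) (c q : R) :
  0 < q -> (forall i, `|e i| = 0 \/ `|e i| = 1) ->
  \sum_(i <- s) `|e i| <= c ->
  `|\sum_(i <- s) b i * e i| `^ q <= c `^ q * \sum_(i <- s) `|b i| `^ q * `|e i|.
Proof.
move=> q0 e01 ec; set M := \sum_(i <- s) `|b i| `^ q * `|e i|.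
have M0 : 0 <= M by apply: sumr_ge0 => i _; rewrite mulr_ge0 ?powR_ge0.
have c0 : 0 <= c by apply: le_trans ec; exact: sumr_ge0.
rewrite -{1}(powRVK M0 (lt0r_neq0 q0)) -powRM ?powR_ge0//.
apply: le_powR; [exact: ltW|exact: normr_ge0|].
apply: le_trans (ler_norm_sum _ _ _) _.
apply: (@le_trans _ _ (\sum_(i <- s) M `^ q^-1 * `|e i|)); last first.
  by rewrite -mulr_sumr mulrC ler_wpM2r// powR_ge0.
rewrite big_seq [leRHS]big_seq; apply: ler_sum => i si; rewrite normrM.
have [->|ei] := e01 i; first by rewrite !mulr0.
rewrite ei !mulr1 -{1}(powRK (normr_ge0 (b i)) (lt0r_neq0 q0)).
apply: le_powR; [by rewrite invr_ge0 ltW|exact: powR_ge0|].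
by rewrite /M (big_rem i)//= ei mulr1 lerDl sumr_ge0.
Qed.

(** The factor 4^q accounts for the rectangles active on one cell. The other 4 is 2 * 2, the
    variation of a product of two interval indicators. *)
Lemma step_function_qvar q (P : {fset (rect R)}) (b : rect R -> R) (x0 y0 : R) s s' :
  0 < q ->
  (forall B, B \in P -> B.1.1 <= B.1.2 /\ B.2.1 <= B.2.2) ->
  (forall B B', B \in P -> B' \in P -> B != B' -> ~~ overlap B B') ->
  path <=%R x0 s -> path <=%R y0 s' ->
  \sum_(k < (size s).-1) \sum_(l < (size s').-1)
    `|increment (fun z => \sum_(B <- P) b B * indic B z)
       (((x0 :: s)`_k, s`_k), ((y0 :: s')`_l, s'`_l))| `^ q <=
  4 `^ q * 4 * \sum_(B <- P) `|b B| `^ q.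
Proof.
move=> q0 hB hP ps ps'.
pose C k l : rect R := (((x0 :: s)`_k, s`_k), ((y0 :: s')`_l, s'`_l)).
apply: (@le_trans _ _ (\sum_(k < (size s).-1) \sum_(l < (size s').-1)
    4 `^ q * \sum_(B <- P) `|b B| `^ q * `|increment (indic B) (C k l)|)).
  apply: ler_sum => k _; apply: ler_sum => l _.
  rewrite (_ : increment _ _ = \sum_(B <- P) b B * increment (indic B) (C k l)); last first.
    rewrite /increment -!sumrB -big_split/=; apply: eq_bigr => B _; lra.
  apply: powR_norm_sum_le => //; first by move=> B; exact: increment_indic_norm.
  exact: sum_increment_indic_le4.
under eq_bigr do rewrite -mulr_sumr; rewrite -mulr_sumr -mulrA.
rewrite ler_wpM2l ?powR_ge0//.
under eq_bigr do rewrite exchange_big; rewrite exchange_big/= mulr_sumr.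
rewrite big_seq [leRHS]big_seq; apply: ler_sum => B BP.
under eq_bigr do rewrite -mulr_sumr; rewrite -mulr_sumr mulrC.
rewrite ler_wpM2r ?powR_ge0//.
under eq_bigr do under eq_bigr do rewrite /C increment_indicE normrM.
under eq_bigr do rewrite -mulr_sumr; rewrite -mulr_suml.
have [hB1 hB2] := hB _ BP; rewrite (_ : 4 = 2 * 2); last lra.
apply: ler_pM; [exact: sumr_ge0|exact: sumr_ge0| |]; exact: indic_variation.
Qed.

Lemma delete_path (a : R) t l : path <=%R a t -> (l.+1 < size t)%N ->
  path <=%R a (delete l t) /\ last a (delete l t) = last a t.
Proof.
elim: t a l => [//|y t IH] a [|l] /=.
  case: t {IH} => [//|z t] /and3P[ay yz pt] _; rewrite /delete/=.
  by rewrite (le_trans ay yz).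
by rewrite ltnS /delete/= -/(delete l t) => /andP[-> pt] lt; exact: IH.
Qed.

Lemma pvar_sum_le_grid p (eps : R) : 1 <= p -> 0 < eps ->
  exists2 c : R, 0 <= c & forall T f A P (v : R), rectangle T A ->
    partitions T A P -> 0 < v ->
    (forall D D', dissections A.1.1 A.1.2 D -> dissections A.2.1 A.2.2 D' ->
       grid_sum p f D D' <= v `^ p) ->
    pvar_sum (p + eps) f P `^ (p + eps)^-1 <= c * v.
Proof.
move=> p1 eps0; set p' := p + eps.
have p0 : 0 < p by apply: lt_le_trans p1.
have p'1 : 1 < p' by rewrite /p'; lra.
have p'0 : 0 < p' by apply: lt_trans p'1.
have p'B0 : 0 < p' - 1 by rewrite subr_gt0.
(* The exponent conjugate to p'. As p < p', 1/p + 1/q = 1 + 1/p - 1/p' exceeds 1. *)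
pose q := p' / (p' - 1); have q0 : 0 < q by rewrite divr_gt0.
have qV : q^-1 = 1 - p'^-1.
  by rewrite invf_div mulrBl divff ?mul1r// gt_eqF.
have pq : 1 < p^-1 + q^-1.
  by rewrite qV addrCA ltrDl subr_gt0 ltf_pV2 ?posrE// /p' ltrDl.
have [K K0 HK] := @young2_bound R p q p0 q0 pq.
exists (K * (4 `^ q * 4) `^ q^-1); first by rewrite mulr_ge0 ?powR_ge0.
move=> T f A P v rA PA v0 Hv; set S := pvar_sum p' f P.
have S0 : 0 <= S by exact: pvar_sum_ge0.
have [->|SN0] := eqVneq S 0.
  by rewrite powR0 ?invr_eq0 ?(lt0r_neq0 p'0)// !mulr_ge0 ?powR_ge0 ?(ltW v0).
have {SN0} S_gt0 : 0 < S by rewrite lt_neqAle eq_sym SN0.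
(* The extremal weights in the duality of l^p' and l^q. *)
pose b B := Num.sg (increment f B) * `|increment f B| `^ (p' - 1).
have bf B : b B * increment f B = `|increment f B| `^ p'.
  by rewrite mulrAC -normrEsg mulr_powRB1.
have bq B : `|b B| `^ q = `|increment f B| `^ p'.
  rewrite /b normrM (ger0_norm (powR_ge0 _ _)) normr_sg.
  have [->|fN0] := eqVneq (increment f B) 0.
    by rewrite mul0r normr0 !powR0 ?(lt0r_neq0 q0) ?(lt0r_neq0 p'0).
  by rewrite mul1r -powRrM mulrC divfK// (lt0r_neq0 p'B0).
pose beta z := \sum_(B <- P) b B * indic B z.
have [h1 h2 h3 _] := (partitionsP P rA).1 PA.
have hB B : B \in P -> B.1.1 <= B.1.2 /\ B.2.1 <= B.2.2.
  by move=> /h1/rectangleE[[_ ? _] [_ ? _]].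
have [D [D' [dD dD' HD]]] := partition_dissections rA PA.
pose x0 := A.1.1 - 1; pose y0 := A.2.1 - 1.
have beta_x0 y : beta (x0, y) = 0.
  rewrite /beta big1_seq// => B /= /h2/andP[/andP[h _] _].
  by rewrite /indic /= leNgt (_ : x0 < _) ?mulr0// /x0; lra.
have beta_y0 x : beta (x, y0) = 0.
  rewrite /beta big1_seq// => B /= /h2/andP[_ /andP[h _]].
  by rewrite /indic /= [_ <= y0]leNgt (_ : y0 < _) ?andbF ?mulr0// /y0; lra.
(* This invariant survives deletions, and it makes [a :: t] a dissection even when [t] has lost its
   first point. *)
pose Q a c (t : seq R) := path <=%R a t /\ last a t = c :> R.
have QD a c t l : Q a c t -> (l.+1 < size t)%N -> Q a c (delete l t).
  by move=> [pt <-] lt; exact: delete_path.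
have Qdiss a c t : Q a c t -> dissections a c (a :: t) by exists t; case: H.
have dissQ a c t : dissections a c t -> Q a c t.
  by move=> [t' [-> pt <-]]; split => //=; rewrite lexx.
pose u := (4 `^ q * 4 * S) `^ q^-1.
have c0 : 0 < 4 `^ q * 4 :> R by rewrite mulr_gt0 ?powR_gt0.
have u0 : 0 < u by rewrite powR_gt0// mulr_gt0.
have sub1 (a d : R) t : Q a d t -> path <=%R (a - 1) t.
  by case: t => [//|z t] [/andP[h pt] _]; apply/andP; split => //; lra.
have := HK beta f x0 y0 u v (Q A.1.1 A.1.2) (Q A.2.1 A.2.2) D D' u0 v0
  beta_x0 beta_y0 (@QD _ _) (@QD _ _).
move=> /(_ _ _ (dissQ _ _ _ dD) (dissQ _ _ _ dD')).
have -> : \sum_(l < size D') young (fun x => beta (x, (y0 :: D')`_l))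
    (fun x => f (x, D'`_l) - f (x, (y0 :: D')`_l)) x0 D = S.
  transitivity (\sum_(B <- P) b B * increment f B); last first.
    by apply: eq_bigr => B _; rewrite bf.
  transitivity (\sum_(i < (size D).-1) \sum_(j < (size D').-1)
      beta (D`_i, D'`_j) * increment f (cell D D' (i : nat, j : nat))); last first.
    rewrite [RHS]big_seq; under [RHS]eq_bigr => B BP do rewrite HD// mulr_sumr.
    rewrite -[RHS]big_seq [RHS]exchange_big; apply: eq_bigr => i _.
    under [RHS]eq_bigr do rewrite mulr_sumr.
    rewrite [RHS]exchange_big; apply: eq_bigr => j _ /=.
    by rewrite /beta mulr_suml; apply: eq_bigr => B _; rewrite mulrA.
  (* The terms at the added points x0 and y0 vanish; the others range over the cells of the grid. *)
  have [s [-> _ _]] := dD; have [s' [-> _ _]] := dD'.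
  rewrite big_ord_recl/= [X in X + _ = _](_ : _ = 0) ?add0r; last first.
    by rewrite /young big1// => k _; rewrite beta_y0 mul0r.
  rewrite [RHS]exchange_big; apply: eq_bigr => l _.
  rewrite young_cons beta_x0 mul0r add0r /young; apply: eq_bigr => k _ /=.
  by congr (_ * _); rewrite /increment/=; lra.
move=> HS; have {HS} : S <= K * (u * v).
  rewrite -[leLHS](ger0_norm S0); apply: HS.
    move=> t t' Qt Qt'.
    have := step_function_qvar b q0 hB h3 (sub1 _ _ _ Qt) (sub1 _ _ _ Qt').
    move=> /le_trans; apply.
    rewrite /u powRVK ?(lt0r_neq0 q0)//; last by rewrite mulr_ge0// ltW.
    by rewrite ler_wpM2l ?(ltW c0)//; apply: ler_sum => B _; rewrite bq.
  move=> t t' Qt Qt'; apply: le_trans (Hv _ _ (Qdiss _ _ _ Qt) (Qdiss _ _ _ Qt')).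
  exact: grid_sum_tail.
rewrite /u (@powRM _ (4 `^ q * 4)) ?(ltW c0)//.
(* The estimate bounds S by a multiple of v * S^(1/q); cancelling S^(1/q) leaves S^(1/p'). *)
have SE : S = S `^ p'^-1 * S `^ q^-1.
  by rewrite -powRD ?(gt_eqF S_gt0) ?implybT// qV addrCA subrr addr0 powRr1.
rewrite {1}SE => H; rewrite -(@ler_pM2r _ (S `^ q^-1)) ?powR_gt0//.
by apply: le_trans H _; rewrite le_eqVlt; apply/orP; left; apply/eqP; lra.
Qed.

Lemma controlled_pvar_le_grid p (eps : R) : 1 <= p -> 0 < eps ->
  exists2 c : R, 1 <= c & forall T f A, rectangle T A ->
    ((c^-1)%:E * controlled_pvar T (p + eps) f A <= grid_pvar p f A)%E.
Proof.
move=> p1 eps0; have p0 : 0 < p by apply: lt_le_trans p1.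
have [c c0 Hc] := pvar_sum_le_grid p1 eps0.
exists (1 + c); first by rewrite lerDl.
move=> T f A rA; have c1 : 0 < 1 + c by lra.
have cV0 : 0 < (1 + c)^-1 by rewrite invr_gt0.
have : (0 <= grid_pvar p f A)%E by exact: poweR_ge0.
have := @grid_pvar_ge R p f A _ _ p0.
case: (grid_pvar p f A) => [V HV V0|_ _|//]; last by rewrite leey.
rewrite muleC -lee_pdivlMr// muleC; apply: ge_ereal_sup => _ [P PA <-].
rewrite invrK -EFinM lee_fin; apply/ler_addgt0Pr => e e0.
(* The value V may vanish while a positive bound is required. The excess is chosen to contribute
   exactly e after multiplication by 1 + c. *)
have v0 : 0 < V + e / (1 + c) by rewrite ltr_wpDl// divr_gt0.
apply: le_trans (Hc T f A P _ rA PA v0 _) _.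
  move=> D D' dD dD'; have := HV _ _ dD dD'; rewrite lee_fin => HD.
  rewrite -[leLHS](powRVK (grid_sum_ge0 p f D D') (lt0r_neq0 p0)).
  apply: le_powR; [exact: ltW|exact: powR_ge0|].
  by apply: le_trans HD _; rewrite lerDl divr_ge0// ltW.
apply: (@le_trans _ _ ((1 + c) * (V + e / (1 + c)))).
  by rewrite ler_wpM2r ?(ltW v0)//; lra.
by rewrite mulrDr [_ * (e / _)]mulrCA divff ?(lt0r_neq0 c1)// mulr1.
Qed.

End GridBound.

(** * Minkowski's inequality *)

Section SuperAdditivity.
Context {R : realType}.

Lemma exists_common_radius (I : eqType) (s : seq I) (Q : I -> R -> Prop) :
  (forall i d d', Q i d -> d' <= d -> Q i d') ->
  (forall i, i \in s -> exists2 d, 0 < d & Q i d) ->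
  exists2 d, 0 < d & forall i, i \in s -> Q i d.
Proof.
move=> Qm; elim: s => [_|i s IH H]; first by exists 1.
have [|d d0 hd] := IH; first by move=> j js; apply: H; rewrite inE js orbT.
have [d' d'0 hd'] := H i (mem_head _ _).
exists (Num.min d d'); first by rewrite lt_min d0.
move=> j; rewrite inE => /orP[/eqP ->|/hd {}hd].
  by apply: Qm hd' _; rewrite ge_min lexx orbT.
by apply: Qm hd _; rewrite ge_min lexx.
Qed.

Lemma norm_powR_near (p a e : R) : 0 < p -> 0 < e ->
  exists2 d, 0 < d & forall y, `|a - y| < d -> `| `|a| `^ p - `|y| `^ p| < e.
Proof.
move=> p0 e0; have pN0 := lt0r_neq0 p0.
(* Differentiability of the power is available at positive bases; at 0 the radius e^(1/p) is
   explicit. *)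
have [->|aN0] := eqVneq a 0.
  exists (e `^ p^-1); first by rewrite powR_gt0.
  move=> y; rewrite sub0r normrN normr0 powR0// sub0r normrN => h.
  rewrite ger0_norm ?powR_ge0// -(powRVK (ltW e0) pN0).
  by apply: gt0_ltr_powR => //; rewrite nnegrE ?powR_ge0.
have na0 : 0 < `|a| by rewrite normr_gt0.
have : {for `|a|, continuous (@powR R ^~ p)}.
  apply: differentiable_continuous; apply/derivable1_diffP.
  by apply: derivable_powR; rewrite in_itv/= na0.
move=> /cvgrPdist_lt/(_ e e0)/nbhs_ballP[d /= d0 hd].
exists d => // y ay; apply: hd; apply: le_lt_trans ay.
by rewrite /=; exact: ler_dist_dist.
Qed.

Lemma convex_powR_le (p t a b : R) : 1 <= p -> 0 <= t <= 1 -> 0 <= a -> 0 <= b ->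
  (t * a + (1 - t) * b) `^ p <= t * a `^ p + (1 - t) * b `^ p.
Proof.
move=> p1 /andP[t0 t1] a0 b0.
by apply: (convex_powR p1 (Itv01 t0 t1)); rewrite inE/= in_itv/= andbT.
Qed.

(** For positive x >= U and y >= V, (u + v)/(x + y) is the convex combination of u/x and v/y with
    weights x/(x + y) and y/(x + y), so convexity of the p-th power applies. Letting x and y
    approach U and V covers vanishing norms. *)
Lemma minkowski_sum (I : Type) (s : seq I) (u v : I -> R) (p : R) : 1 <= p ->
  (forall i, 0 <= u i) -> (forall i, 0 <= v i) ->
  (\sum_(i <- s) (u i + v i) `^ p) `^ p^-1 <=
  (\sum_(i <- s) u i `^ p) `^ p^-1 + (\sum_(i <- s) v i `^ p) `^ p^-1.
Proof.
move=> p1 u0 v0; have p0 : 0 < p by apply: lt_le_trans p1.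
have pN0 := lt0r_neq0 p0.
set U := (\sum_(i <- s) u i `^ p) `^ p^-1; set V := (\sum_(i <- s) v i `^ p) `^ p^-1.
suff key x y : 0 < x -> 0 < y -> U <= x -> V <= y ->
    (\sum_(i <- s) (u i + v i) `^ p) `^ p^-1 <= x + y.
  apply/ler_addgt0Pr => e e0; have e20 : 0 < e / 2 by rewrite divr_gt0.
  have -> : U + V + e = (U + e / 2) + (V + e / 2) by lra.
  by apply: key; rewrite ?ltr_wpDl ?powR_ge0// lerDl ltW.
move=> x0 y0 Ux Vy; have xy0 : 0 < x + y by rewrite addr_gt0.
rewrite -[leRHS](powRK (ltW xy0) pN0).
have sumS (w : I -> R) : 0 <= \sum_(i <- s) w i `^ p.
  by apply: sumr_ge0 => i _; exact: powR_ge0.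
apply: le_powR; [by rewrite invr_ge0 ltW|exact: sumS|].
have Ux' : \sum_(i <- s) u i `^ p <= x `^ p.
  rewrite -[leLHS](powRVK _ pN0)//.
  by apply: le_powR => //; [exact: ltW|exact: powR_ge0].
have Vy' : \sum_(i <- s) v i `^ p <= y `^ p.
  rewrite -[leLHS](powRVK _ pN0)//.
  by apply: le_powR => //; [exact: ltW|exact: powR_ge0].
have t01 : 0 <= x / (x + y) <= 1.
  by rewrite (divr_ge0 (ltW x0) (ltW xy0)) ler_pdivrMr// mul1r lerDl ltW.
have xyN0 := lt0r_neq0 xy0.
have tE : 1 - x / (x + y) = y / (x + y).
  by rewrite -{1}(divff xyN0) -mulrBl [x + y]addrC addrK.
have conv i : (u i + v i) `^ p <= (x + y) `^ p *
    (x / (x + y) * (u i `^ p / x `^ p) + y / (x + y) * (v i `^ p / y `^ p)).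
  have := convex_powR_le p1 t01 (divr_ge0 (u0 i) (ltW x0)) (divr_ge0 (v0 i) (ltW y0)).
  rewrite tE !powR_div// => H.
  have -> : u i + v i = (x + y) * (x / (x + y) * (u i / x) + y / (x + y) * (v i / y)).
    have aux z w : z != 0 -> (x + y) * (z / (x + y) * (w / z)) = w.
      by move=> zN0; rewrite (mulrA (x + y)) [(x + y) * _]mulrC (divfK xyN0) mulrC (divfK zN0).
    by rewrite mulrDr !aux ?lt0r_neq0.
  rewrite powRM ?(ltW xy0)//; first by rewrite ler_wpM2l// powR_ge0.
  have [t0 t1] := andP t01; rewrite addr_ge0// mulr_ge0//.
  - by rewrite divr_ge0// ltW.
  - by rewrite divr_ge0// ltW.
  - by rewrite divr_ge0// ltW.
apply: (le_trans (ler_sum _ (fun i _ => conv i))).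
rewrite -mulr_sumr big_split/= -!mulr_sumr -!mulr_suml ler_piMr ?powR_ge0//.
rewrite -[leRHS](divff xyN0) mulrDl.
have h (a b c : R) : 0 <= a -> 0 < b -> c <= b -> a * (c / b) <= a.
  by move=> a0 b0 cb; apply: ler_piMr => //; rewrite ler_pdivrMr// mul1r.
by apply: lerD; apply: h; rewrite ?powR_gt0// divr_ge0// ltW.
Qed.
End SuperAdditivity.

(** * Super-additivity of the controlled p-variation *)

Section PVariation.
Context {R : realType} (T p : R).
Implicit Types (f : R * R -> R) (A B : rect R) (I J : R * R).
Hypothesis T0 : 0 < T.
Hypothesis p1 : 1 <= p.

Let p0 : 0 < p. Proof. exact: lt_le_trans p1. Qed.
Let pN0 : p != 0. Proof. exact: lt0r_neq0. Qed.

(** Real-valued, as controls are; [fine] sends +oo to 0, a case that [pvar_fin_num] excludes for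
    finite controlled variation. *)
Definition pvar f A : R := fine (controlled_pvar T p f A `^ p)%E.

Lemma partition_mem A B : rectangle T A -> rectangle T B -> subrect B A ->
  exists2 P, partitions T A P & B \in P.
Proof.
move=> rA /rectangleE[[_ a _] [_ b _]] /andP[/andP[c d] /andP[e g]].
have D1 : dissections A.1.1 A.1.2 [:: A.1.1; B.1.1; B.1.2; A.1.2].
  by exists [:: B.1.1; B.1.2; A.1.2]; rewrite /= c a d.
have D2 : dissections A.2.1 A.2.2 [:: A.2.1; B.2.1; B.2.2; A.2.2].
  by exists [:: B.2.1; B.2.2; A.2.2]; rewrite /= e b g.
have [P [PA H _]] := @partition_grid R T p (fun=> 0) A _ _ p0 rA D1 D2 isT isT.
exists P => //; have := H 1%N 1%N isT isT.
by rewrite /cell/=; case: (B) => [[? ?] [? ?]].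
Qed.

(** In a partition of [A] that has [B] as a member, [B] is replaced by a partition of [B]. Working
    in the extended reals lets this also provide finiteness on subrectangles. *)
Lemma ereal_pvar_mono f A B : rectangle T A -> rectangle T B -> subrect B A ->
  (controlled_pvar T p f B `^ p <= controlled_pvar T p f A `^ p)%E.
Proof.
move=> rA rB BA; rewrite !controlled_pvar_poweR//.
apply: ge_ereal_sup => _ [Q QB <-]; have [P PA BP] := partition_mem rA rB BA.
pose q C := if C == B then Q else [fset C]%fset.
have [|P' [P'A H]] := @partition_refine R T p f A P q p0 rA PA.
  move=> C CP; rewrite /q; case: eqP => [->//|_].
  by apply: partition_set1; have [h _ _ _] := (partitionsP P rA).1 PA; exact: h.
apply: le_ereal_sup_tmp; exists (pvar_sum p f P')%:E; first by exists P'.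
rewrite lee_fin; apply: le_trans H.
rewrite (bigD1_seq B) ?fset_uniq//= {1}/q eqxx lerDl sumr_ge0// => C _.
exact: pvar_sum_ge0.
Qed.

Section FiniteVariation.
Context (f : R * R -> R).
Hypothesis fin : finite_controlled_pvar T p f.

Lemma rectangle_square : rectangle T (square T).
Proof. by apply/rectangleE; split; split => //=; exact: ltW. Qed.

Lemma rectangle_subrect_square A : rectangle T A -> subrect A (square T).
Proof. by move=> /rectangleE[[a b c] [d e g]]; rewrite /subrect /subI/= a c d g. Qed.

Lemma pvar_fin_num A : rectangle T A ->
  (controlled_pvar T p f A `^ p)%E \is a fin_num.
Proof.
move=> rA; rewrite ge0_fin_numE ?poweR_ge0//.
apply: le_lt_trans (ereal_pvar_mono f rectangle_square rA (rectangle_subrect_square rA)) _.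
exact: poweR_lty.
Qed.

Lemma pvarK A : rectangle T A ->
  (pvar f A)%:E = ereal_sup [set (pvar_sum p f P)%:E | P in partitions T A].
Proof. by move=> rA; rewrite fineK ?pvar_fin_num// controlled_pvar_poweR. Qed.

Lemma pvar_ge A P : rectangle T A -> partitions T A P -> pvar_sum p f P <= pvar f A.
Proof.
by move=> rA PA; rewrite -lee_fin pvarK//; apply: ereal_sup_ubound; exists P.
Qed.

Lemma pvar_le A x : rectangle T A ->
  (forall P, partitions T A P -> pvar_sum p f P <= x) -> pvar f A <= x.
Proof.
move=> rA h; rewrite -lee_fin pvarK//; apply: ge_ereal_sup => _ [P PA <-].
by rewrite lee_fin h.
Qed.

Lemma pvar_adherent A e : rectangle T A -> 0 < e ->
  exists2 P, partitions T A P & pvar f A - e < pvar_sum p f P.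
Proof.
move=> rA e0; apply/not_exists2P => H.
suff : pvar f A <= pvar f A - e by lra.
by apply: pvar_le => // P PA; have [//|/negP] := H P; rewrite -leNgt.
Qed.

Lemma pvar_ge0 A : 0 <= pvar f A.
Proof. by rewrite fine_ge0// poweR_ge0. Qed.

Lemma pvar_mono A B : rectangle T A -> rectangle T B -> subrect B A ->
  pvar f B <= pvar f A.
Proof.
by move=> rA rB BA; apply: fine_le; rewrite ?pvar_fin_num//; exact: ereal_pvar_mono.
Qed.

Lemma pvar_degenerate A : rectangle T A -> degenerate A -> pvar f A = 0.
Proof.
move=> rA dA; apply/eqP; rewrite eq_le pvar_ge0 andbT; apply: pvar_le => // P PA.
have [h1 h2 _ _] := (partitionsP P rA).1 PA.
rewrite /pvar_sum big1_seq// => B /= BP; rewrite increment_degenerate ?normr0 ?powR0//.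
have /rectangleE[[_ a _] [_ b _]] := h1 _ BP.
have /andP[/andP[c d] /andP[e g]] := h2 _ BP.
by case: dA => h; [left|right]; apply/eqP; rewrite eq_le ?a ?b /=; lra.
Qed.

Lemma pvar_super_additive : super_additive T (pvar f).
Proof.
split => [A _|A P rA PA]; first exact: pvar_ge0.
have [h1 _ _ _] := (partitionsP P rA).1 PA.
(* Each member gets a near-optimal partition with error e'; the errors add up to at most e. *)
apply/ler_addgt0Pr => e e0; pose e' := e / (size P).+1%:R.
have e'0 : 0 < e' by rewrite divr_gt0.
have /choice[Q HQ] : forall B, exists Q, B \in P ->
    partitions T B Q /\ pvar f B - e' < pvar_sum p f Q.
  move=> B; have [/h1 rB|] := boolP (B \in P); last by exists fset0.
  by have [Q ? ?] := pvar_adherent rB e'0; exists Q.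
have [|P' [P'A H]] := @partition_refine R T p f A P Q p0 rA PA.
  by move=> B /HQ[].
apply: (@le_trans _ _ (\sum_(B <- P) (pvar_sum p f (Q B) + e'))).
  rewrite big_seq [leRHS]big_seq; apply: ler_sum => B /HQ[_ h].
  by rewrite -lerBlDr ltW.
rewrite big_split/= lerD//; first exact: le_trans H (pvar_ge rA P'A).
rewrite big_const_seq count_predT iter_addr addr0 -mulr_natr mulrAC.
by rewrite ler_pdivrMr// ler_wpM2l ?(ltW e0)// ler_nat.
Qed.

(** If [B] and [B'] coincide, the partition contains them only once; degeneracy then makes counting
    them twice harmless. *)
Lemma pvar_split A B B' : rectangle T A ->
  (exists P, [/\ partitions T A P, B \in P & B' \in P]) ->
  (B = B' -> degenerate B) -> pvar f B + pvar f B' <= pvar f A.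
Proof.
move=> rA [P [PA BP B'P]] dB; apply: le_trans (pvar_super_additive.2 _ _ rA PA).
have [h1 _ _ _] := (partitionsP P rA).1 PA.
have [BB|nBB] := eqVneq B B'.
  rewrite -BB (pvar_degenerate (h1 _ BP) (dB BB)) addr0 sumr_ge0// => C _.
  exact: pvar_ge0.
rewrite (bigD1_seq B) ?fset_uniq//= lerD2l (big_rem B')//= eq_sym nBB lerDl.
by rewrite sumr_ge0// => C _; exact: pvar_ge0.
Qed.

Lemma pvar_split1 (a m b : R) J : rectangle T ((a, b), J) -> a <= m <= b ->
  pvar f ((a, m), J) + pvar f ((m, b), J) <= pvar f ((a, b), J).
Proof.
move=> rA /andP[am mb]; apply: (pvar_split rA); last by move=> -[-> _]; left.
have /rectangleE[_ [_ J12 _]] := rA.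
have D1 : dissections a b [:: a; m; b] by exists [:: m; b]; rewrite /= am mb.
have D2 : dissections J.1 J.2 [:: J.1; J.2] by exists [:: J.2]; rewrite /= andbT.
have [P [PA H _]] := @partition_grid R T p f ((a, b), J) _ _ p0 rA D1 D2 isT isT.
exists P; split => //.
  by have := H 0%N 0%N isT isT; rewrite /cell/=; case: (J).
by have := H 1%N 0%N isT isT; rewrite /cell/=; case: (J).
Qed.

(** A partition of [A] is clamped onto [A1] and onto [A2]; the increments add, and Minkowski's
    inequality is the triangle inequality for the two families. *)
Lemma pvar_subadditive A A1 A2 : rectangle T A -> rectangle T A1 -> rectangle T A2 ->
  subrect A1 A -> subrect A2 A ->
  (forall B, rectangle T B -> subrect B A ->
     increment f B = increment f (clamp A1 B) + increment f (clamp A2 B)) ->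
  pvar f A `^ p^-1 <= pvar f A1 `^ p^-1 + pvar f A2 `^ p^-1.
Proof.
move=> rA rA1 rA2 A1A A2A hf.
have key x : 0 <= x -> pvar f A <= x `^ p -> pvar f A `^ p^-1 <= x.
  move=> x0 h; rewrite -[leRHS](powRK x0 pN0).
  by apply: le_powR; rewrite ?invr_ge0 ?(ltW p0) ?pvar_ge0.
apply: key; first by rewrite addr_ge0 ?powR_ge0.
apply: pvar_le => // P PA; have [h1 h2 _ _] := (partitionsP P rA).1 PA.
have [P1 [P1A H1]] := @partition_clamp R T p f A A1 P p0 rA rA1 A1A PA.
have [P2 [P2A H2]] := @partition_clamp R T p f A A2 P p0 rA rA2 A2A PA.
rewrite -[leLHS](powRVK (pvar_sum_ge0 p f P) pN0).
apply: le_powR; [exact: ltW|exact: powR_ge0|].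
have pV0 : 0 <= p^-1 by rewrite invr_ge0 ltW.
have mono P' A' Q : rectangle T A' -> partitions T A' P' ->
    \sum_(B <- P) `|increment f (Q B)| `^ p <= pvar_sum p f P' ->
    (\sum_(B <- P) `|increment f (Q B)| `^ p) `^ p^-1 <= pvar f A' `^ p^-1.
  move=> rA' PA' H; apply: le_powR => //.
    by apply: sumr_ge0 => B _; exact: powR_ge0.
  exact: le_trans H (pvar_ge rA' PA').
apply: le_trans (lerD (mono _ _ _ rA1 P1A H1) (mono _ _ _ rA2 P2A H2)).
apply: le_trans (minkowski_sum (P : seq _) p1
  (fun B => normr_ge0 (increment f (clamp A1 B)))
  (fun B => normr_ge0 (increment f (clamp A2 B)))).
apply: le_powR => //; first exact: pvar_sum_ge0.
rewrite /pvar_sum big_seq [leRHS]big_seq; apply: ler_sum => B BP.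
apply: le_powR; [exact: ltW|exact: normr_ge0|].
by rewrite (hf B (h1 _ BP) (h2 _ BP)); exact: ler_normD.
Qed.

Lemma pvar_subadditive1 (a m b : R) J : rectangle T ((a, b), J) -> a <= m <= b ->
  pvar f ((a, b), J) `^ p^-1 <=
    pvar f ((a, m), J) `^ p^-1 + pvar f ((m, b), J) `^ p^-1.
Proof.
move=> rA /andP[am mb]; have /rectangleE[/= [a0 ab bT] [J0 J12 JT]] := rA.
apply: (pvar_subadditive rA).
- by apply/rectangleE => /=; split; split => //; lra.
- by apply/rectangleE => /=; split; split => //; lra.
- by rewrite /subrect /subI/= !lexx mb.
- by rewrite /subrect /subI/= !lexx am.
move=> [[x x'] [y y']] /rectangleE[/= [_ xx' _] [_ yy' _]].
move=> /andP[/andP[/= ax x'b] /andP[/= Jy y'J]].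
(* Each endpoint is fixed by one clamp and sent to m by the other, so the two clamps cut a rectangle
   along the line at m. *)
have clampE z : a <= z <= b ->
    (clampI (a, m) z = z /\ clampI (m, b) z = m) \/
    (clampI (a, m) z = m /\ clampI (m, b) z = z).
  move=> /andP[az zb]; rewrite /clampI/= (min_idPr zb).
  have [zm|mz] := leP z m; [left|right].
    by rewrite (max_idPr az).
  by rewrite (max_idPr am).
rewrite /clamp/= !(@clampI_id _ J)//; [|lra..].
have axb : a <= x <= b by apply/andP; split; lra.
have ax'b : a <= x' <= b by apply/andP; split; lra.
by case: (clampE _ axb) => -[-> ->]; case: (clampE _ ax'b) => -[-> ->];
  rewrite /increment/=; lra.
Qed.

End FiniteVariation.
End PVariation.

(** * Continuity of the controlled p-variation *)

Section Continuity.
Context {R : realType} (T p : R).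
Implicit Types (d e : R) (f : R * R -> R) (A B : rect R) (I J : R * R).
Hypothesis T0 : 0 < T.
Hypothesis p1 : 1 <= p.

Let p0 : 0 < p. Proof. exact: lt_le_trans p1. Qed.
Let pN0 : p != 0. Proof. exact: lt0r_neq0. Qed.

Definition near_rect d A A' : bool :=
  [&& `|A.1.1 - A'.1.1| < d, `|A.1.2 - A'.1.2| < d,
      `|A.2.1 - A'.2.1| < d & `|A.2.2 - A'.2.2| < d].

(** A point of [I] outside [I'] lies between corresponding ends of the two intervals, so it moves no
    further than those ends are apart. *)
Lemma clampI_near I I' (d x : R) : I'.1 <= I'.2 -> I.1 <= x <= I.2 ->
  `|I.1 - I'.1| < d -> `|I.2 - I'.2| < d -> `|x - clampI I' x| < d.
Proof.
rewrite /clampI => I12 /andP[h1 h2]; rewrite !ltr_norml => /andP[h3 h4] /andP[h5 h6].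
case: (leP I'.2 x) => h7; [|case: (leP I'.1 x) => h8].
- by rewrite (max_idPr I12); apply/andP; split; lra.
- by rewrite subrr; apply/andP; split; lra.
- by apply/andP; split; lra.
Qed.

Lemma near_rect_le d d' A A' : d <= d' -> near_rect d A A' -> near_rect d' A A'.
Proof.
move=> dd /and4P[a b c e].
by apply/and4P; split; apply: lt_le_trans dd.
Qed.

Section ContinuousFunction.
Context (f : R * R -> R).
Hypothesis fin : finite_controlled_pvar T p f.
Hypothesis cf : {within region (square T), continuous f}.

Lemma continuous_square_near c e : region (square T) c -> 0 < e ->
  exists2 d, 0 < d & forall z, region (square T) z ->
    `|c.1 - z.1| < d -> `|c.2 - z.2| < d -> `|f c - f z| < e.
Proof.
move=> sc e0; move/subspace_continuousP : cf => /(_ c sc)/cvgrPdist_lt/(_ e e0).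
rewrite near_withinE => /nbhs_ballP[d /= d0 hd]; exists d => // z sz h1 h2.
by apply: hd => //; split.
Qed.

Lemma increment_clamp_near A B e : rectangle T A -> rectangle T B ->
  subrect B A -> 0 < e ->
  exists2 d, 0 < d & forall A', rectangle T A' -> subrect A' A ->
    near_rect d A A' -> `|increment f B - increment f (clamp A' B)| < e.
Proof.
move=> rA rB BA e0; have e4 : 0 < e / 4 by rewrite divr_gt0.
have Bsq := rectangle_subrect_square rB.
have /rectangleE[[_ B1 _] [_ B2 _]] := rB.
have corner x y : x \in [:: B.1.1; B.1.2] -> y \in [:: B.2.1; B.2.2] ->
    exists2 d, 0 < d & forall A', rectangle T A' -> subrect A' A -> near_rect d A A' ->
      `|f (x, y) - f (clampI A'.1 x, clampI A'.2 y)| < e / 4.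
  move=> xB yB.
  have Bxy : region B (x, y).
    rewrite regionE/=; move: xB yB; rewrite !inE.
    by move=> /orP[]/eqP -> /orP[]/eqP ->; rewrite ?lexx ?B1 ?B2.
  have [d d0 hd] := continuous_square_near (subrect_region Bsq Bxy) e4.
  exists d => // A' rA' A'A /and4P[n1 n2 n3 n4].
  have /regionE/andP[/= Ax Ay] := subrect_region BA Bxy.
  have /rectangleE[[_ A'1 _] [_ A'2 _]] := rA'.
  apply: hd; [|exact: clampI_near A'1 Ax n1 n2|exact: clampI_near A'2 Ay n3 n4].
  apply: (subrect_region (rectangle_subrect_square rA')).
  by rewrite regionE/= !clampI_bounds.
have last2 (x y : R) : y \in [:: x; y] by rewrite !inE eqxx orbT.
have c11 := corner _ _ (mem_head _ _) (mem_head _ _).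
have c12 := corner _ _ (mem_head _ _) (last2 _ _).
have c21 := corner _ _ (last2 _ _) (mem_head _ _).
have c22 := corner _ _ (last2 _ _) (last2 _ _).
case: c11 c12 c21 c22 => [d1 d10 h1] [d2 d20 h2] [d3 d30 h3] [d4 d40 h4].
exists (Num.min (Num.min d1 d2) (Num.min d3 d4)); first by rewrite !lt_min d10 d20 d30.
move=> A' rA' A'A nA.
have m d : Num.min (Num.min d1 d2) (Num.min d3 d4) <= d -> near_rect d A A'.
  by move=> hd; apply: near_rect_le nA.
have m1 : near_rect d1 A A' by apply: m; rewrite !ge_min lexx.
have m2 : near_rect d2 A A' by apply: m; rewrite !ge_min lexx orbT.
have m3 : near_rect d3 A A' by apply: m; rewrite !ge_min lexx !orbT.
have m4 : near_rect d4 A A' by apply: m; rewrite !ge_min lexx !orbT.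
have := h4 A' rA' A'A m4; have := h3 A' rA' A'A m3.
have := h2 A' rA' A'A m2; have := h1 A' rA' A'A m1; rewrite !ltr_norml.
move=> /andP[a1 a2] /andP[a3 a4] /andP[a5 a6] /andP[a7 a8].
by rewrite /increment/=; apply/andP; split; lra.
Qed.

(** Half of e pays for a near-optimal partition of [A], the other half for the change of its
    finitely many increments when it is clamped onto [A']. *)
Lemma pvar_lower_semicontinuous A e : rectangle T A -> 0 < e ->
  exists2 d, 0 < d & forall A', rectangle T A' -> subrect A' A ->
    near_rect d A A' -> pvar T p f A - e <= pvar T p f A'.
Proof.
move=> rA e0; have e20 : 0 < e / 2 by rewrite divr_gt0.
have [P PA hP] := pvar_adherent T0 p1 fin rA e20.
have [h1 h2 _ _] := (partitionsP P rA).1 PA.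
pose e' := e / 2 / (size P).+1%:R; have e'0 : 0 < e' by rewrite divr_gt0.
pose Q B d := forall A', rectangle T A' -> subrect A' A -> near_rect d A A' ->
  `|increment f B| `^ p - e' <= `|increment f (clamp A' B)| `^ p.
have [||d d0 hd] := @exists_common_radius R _ (P : seq _) Q.
- move=> B d d' hB dd A' rA' A'A nA; apply: hB => //; exact: near_rect_le nA.
- move=> B BP; have [z z0 hz] := norm_powR_near (increment f B) p0 e'0.
  have [d d0 hd] := increment_clamp_near rA (h1 _ BP) (h2 _ BP) z0.
  exists d => // A' rA' A'A nA; have := hz _ (hd _ rA' A'A nA).
  by rewrite ltr_norml => /andP[_]; lra.
exists d => // A' rA' A'A nA.
have [P' [P'A' H]] := @partition_clamp R T p f A A' P p0 rA rA' A'A PA.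
apply: le_trans (le_trans H (pvar_ge T0 p1 fin rA' P'A')).
have : pvar_sum p f P - e / 2 <= \sum_(B <- P) `|increment f (clamp A' B)| `^ p.
  apply: (@le_trans _ _ (\sum_(B <- P) (`|increment f B| `^ p - e'))).
    rewrite sumrB lerD2l lerN2 big_const_seq count_predT iter_addr addr0.
    by rewrite -[e' *+ _]mulr_natr /e' mulrAC ler_pdivrMr// ler_wpM2l ?(ltW e20)// ler_nat.
  by rewrite big_seq [leRHS]big_seq; apply: ler_sum => B BP; exact: hd.
by move=> h; lra.
Qed.

(** The p-th root, for which cutting a rectangle gives a triangle inequality; continuity is proved
    for it first. *)
Definition pnorm g A : R := pvar T p g A `^ p^-1.

(** Full height makes the estimates uniform in the other side; minimum and maximum make it
    symmetric. *)
Definition strip (x y : R) : rect R := ((Num.min x y, Num.max x y), (0, T)).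

Lemma strip_rectangle (x y : R) : 0 <= x <= T -> 0 <= y <= T -> rectangle T (strip x y).
Proof.
move=> /andP[a b] /andP[c d]; apply/rectangleE => /=; split; split => //; last exact: ltW.
- by rewrite le_min a.
- by rewrite ge_min !le_max lexx.
- by rewrite ge_max b.
Qed.

(* Superadditivity across the line [x = y]: what the large part keeps by lower
   semicontinuity, the thin strip loses. *)
Lemma pvar_strip_small (x e : R) : 0 <= x <= T -> 0 < e ->
  exists2 d, 0 < d & forall y, 0 <= y <= T -> `|x - y| < d ->
    pvar T p f (strip x y) <= e.
Proof.
move=> /andP[x0 xT] e0.
have rR : rectangle T ((x, T), (0, T)).
  by apply/rectangleE; split; split => //=; exact: ltW.
have rL : rectangle T ((0, x), (0, T)).
  by apply/rectangleE; split; split => //=; exact: ltW.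
have [d d0 hd] := pvar_lower_semicontinuous rR e0.
have [d' d'0 hd'] := pvar_lower_semicontinuous rL e0.
exists (Num.min d d'); first by rewrite lt_min d0.
move=> y /andP[y0 yT]; rewrite lt_min => /andP[n1 n2].
rewrite /strip; have [xy|yx] := leP x y.
  have rA' : rectangle T ((y, T), (0, T)).
    by apply/rectangleE; split; split => //=; exact: ltW.
  have := pvar_split1 T0 p1 fin rR (introT andP (conj xy yT)).
  have := hd _ rA'; rewrite /subrect /subI /near_rect/= !subrr !normr0 d0 n1 !lexx xy.
  by move=> /(_ isT isT); lra.
have rA' : rectangle T ((0, y), (0, T)).
  by apply/rectangleE; split; split => //=; exact: ltW.
have := pvar_split1 T0 p1 fin rL (introT andP (conj y0 (ltW yx))).
have := hd' _ rA'; rewrite /subrect /subI /near_rect/= !subrr !normr0 d'0 n2 !lexx (ltW yx).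
by move=> /(_ isT isT); lra.
Qed.

Lemma pnorm_mono A B : rectangle T A -> rectangle T B -> subrect B A ->
  pnorm f B <= pnorm f A.
Proof.
move=> rA rB BA; apply: le_powR; [by rewrite invr_ge0 ltW|exact: pvar_ge0|].
exact: (pvar_mono T0 p1 fin).
Qed.

Lemma pnorm_ge0 A : 0 <= pnorm f A. Proof. exact: powR_ge0. Qed.

(** If a' < a, monotonicity suffices. Otherwise the piece cut off between a and a' lies in the
    strip. *)
Lemma pnorm_left_le (a a' b : R) J : rectangle T ((a, b), J) ->
  rectangle T ((a', b), J) ->
  pnorm f ((a, b), J) <= pnorm f ((a', b), J) + pnorm f (strip a a').
Proof.
move=> r r'; have /rectangleE[/= [a0 ab bT] [J0 J12 JT]] := r.
have /rectangleE[/= [a'0 a'b _] _] := r'.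
have [aa'|a'a] := leP a a'; last first.
  rewrite -[leLHS]addr0; apply: lerD; last exact: pnorm_ge0.
  by apply: pnorm_mono => //; rewrite /subrect /subI/= !lexx (ltW a'a).
apply: le_trans (pvar_subadditive1 T0 p1 fin r (introT andP (conj aa' a'b))) _.
rewrite [leLHS]addrC lerD2l.
have rs : rectangle T (strip a a').
  by apply: strip_rectangle; apply/andP; split; lra.
rewrite -/(pnorm f _); apply: pnorm_mono => //.
  by apply/rectangleE; split; split => //=; lra.
by rewrite /subrect /subI /strip/= ge_min le_max !lexx J0 JT orbT.
Qed.

Lemma pnorm_right_le (a b b' : R) J : rectangle T ((a, b), J) ->
  rectangle T ((a, b'), J) ->
  pnorm f ((a, b), J) <= pnorm f ((a, b'), J) + pnorm f (strip b b').
Proof.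
move=> r r'; have /rectangleE[/= [a0 ab bT] [J0 J12 JT]] := r.
have /rectangleE[/= [_ ab' b'T] _] := r'.
have [bb'|b'b] := leP b b'.
  rewrite -[leLHS]addr0; apply: lerD; last exact: pnorm_ge0.
  by apply: pnorm_mono => //; rewrite /subrect /subI/= !lexx bb'.
apply: le_trans (pvar_subadditive1 T0 p1 fin r (introT andP (conj ab' (ltW b'b)))) _.
rewrite lerD2l.
have rs : rectangle T (strip b b').
  by apply: strip_rectangle; apply/andP; split; lra.
rewrite -/(pnorm f _); apply: pnorm_mono => //.
  by apply/rectangleE; split; split => //=; lra.
by rewrite /subrect /subI /strip/= ge_min le_max !lexx J0 JT !orbT.
Qed.

(** One end moves at a time. The intermediate interval must not be reversed, so the left end moves
    first if a' <= b, and the right end otherwise. *)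
Lemma pnorm_change1 I I' J : rectangle T (I, J) -> rectangle T (I', J) ->
  pnorm f (I, J) <=
    pnorm f (I', J) + pnorm f (strip I.1 I'.1) + pnorm f (strip I.2 I'.2).
Proof.
case: I I' => [a b] [a' b'] r r' /=.
have /rectangleE[/= [a0 ab bT] [J0 J12 JT]] := r.
have /rectangleE[/= [a'0 a'b' b'T] _] := r'.
have [a'b|ba'] := leP a' b.
  have rm : rectangle T ((a', b), J) by apply/rectangleE; split; split => //=; lra.
  apply: le_trans (pnorm_left_le r rm) _; rewrite [leRHS]addrAC lerD2r.
  exact: pnorm_right_le.
have rm : rectangle T ((a, b'), J) by apply/rectangleE; split; split => //=; lra.
apply: le_trans (pnorm_right_le r rm) _; rewrite lerD2r.
exact: pnorm_left_le.
Qed.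

Lemma stripC (x y : R) : strip x y = strip y x.
Proof. by rewrite /strip minC maxC. Qed.

(** Two strips of norm at most e / 2 bound the change. The radius does not depend on [J], so the two
    sides of a rectangle can be moved one after the other. *)
Lemma pnorm_near1 I e : Delta T I -> 0 < e ->
  exists2 d, 0 < d & forall I' J, Delta T I' -> Delta T J ->
    `|I.1 - I'.1| < d -> `|I.2 - I'.2| < d ->
    `|pnorm f (I, J) - pnorm f (I', J)| <= e.
Proof.
move=> dI e0; have [I1 [I12 I2]] := dI.
have e20 : 0 < (e / 2) `^ p by rewrite powR_gt0// divr_gt0.
have I1T : 0 <= I.1 <= T by rewrite I1 (le_trans I12).
have I2T : 0 <= I.2 <= T by rewrite I2 (le_trans I1).
have [d d0 hd] := pvar_strip_small I1T e20.
have [d' d'0 hd'] := pvar_strip_small I2T e20.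
exists (Num.min d d'); first by rewrite lt_min d0.
move=> I' J dI' dJ; rewrite !lt_min => /andP[n1 _] /andP[_ n2].
have [I'1 [I'12 I'2]] := dI'.
have I'1T : 0 <= I'.1 <= T by rewrite I'1 (le_trans I'12).
have I'2T : 0 <= I'.2 <= T by rewrite I'2 (le_trans I'1).
have small x y : pvar T p f (strip x y) <= (e / 2) `^ p -> pnorm f (strip x y) <= e / 2.
  move=> h; rewrite -[leRHS](powRK _ pN0); last by rewrite divr_ge0// ltW.
  by apply: le_powR => //; [rewrite invr_ge0 ltW|exact: pvar_ge0].
have r : rectangle T (I, J) by split.
have r' : rectangle T (I', J) by split.
have s1 := small _ _ (hd _ I'1T n1); have s2 := small _ _ (hd' _ I'2T n2).
have c1 := pnorm_change1 r r'; have := pnorm_change1 r' r.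
rewrite (stripC I'.1) (stripC I'.2) => c2.
have [h h'] : pnorm f (I, J) <= pnorm f (I', J) + e /\
    pnorm f (I', J) <= pnorm f (I, J) + e.
  have {}s1 := lerD s1 s2; rewrite -splitr in s1.
  rewrite -addrA in c1; rewrite -addrA in c2.
  by split; [apply: le_trans c1 _|apply: le_trans c2 _]; rewrite lerD2l.
by rewrite ler_distl; apply/andP; split; [rewrite lerBlDr; exact: h'|exact: h].
Qed.

End ContinuousFunction.

(** * Exchange of the two coordinates, and the 2D control *)

Definition swap_fun f : R * R -> R := fun z => f (z.2, z.1).

Lemma controlled_pvar_swap_le f I J : rectangle T (I, J) ->
  (controlled_pvar T p f (I, J) <= controlled_pvar T p (swap_fun f) (J, I))%E.
Proof.
move=> rA; have rA' : rectangle T (J, I) by case: rA.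
apply: ge_ereal_sup => _ [P PA <-]; have [h1 h2 h3 h4] := (partitionsP P rA).1 PA.
have [||||P' [P'A _ H]] := @partition_of_family R T p (swap_fun f) (J, I) _ (P : seq _)
  (fun B : rect R => (B.2, B.1)) p0 rA'.
- exact: fset_uniq.
- move=> B BP; have [? ?] := h1 _ BP; have /andP[? ?] := h2 _ BP.
  by split; [split|apply/andP].
- by move=> B C BP CP /(h3 _ _ BP CP); rewrite /overlap andbC.
- move=> [x y] /regionE/andP[/= hx hy]; have [|B BP Bx] := h4 (y, x).
    by rewrite regionE/= hx hy.
  by exists B => //; move: Bx; rewrite !regionE andbC.
apply: le_trans (controlled_pvar_ge p (swap_fun f) P'A); rewrite lee_fin.
apply: le_powR; [by rewrite invr_ge0 ltW|exact: pvar_sum_ge0|].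
apply: le_trans H; apply: ler_sum => B _; rewrite le_eqVlt; apply/orP; left.
by apply/eqP; congr (`|_| `^ _); rewrite /increment /swap_fun/=; lra.
Qed.

Lemma swap_funK f : swap_fun (swap_fun f) = f.
Proof. by apply/funext => -[x y]. Qed.

Lemma controlled_pvar_swap f I J : rectangle T (I, J) ->
  controlled_pvar T p f (I, J) = controlled_pvar T p (swap_fun f) (J, I).
Proof.
move=> rA; have rA' : rectangle T (J, I) by case: rA.
have le1 := controlled_pvar_swap_le f rA.
have le2 := controlled_pvar_swap_le (swap_fun f) rA'; rewrite swap_funK in le2.
by apply/eqP; rewrite eq_le; apply/andP; split; [exact: le1|exact: le2].
Qed.

Lemma finite_controlled_pvar_swap f : finite_controlled_pvar T p f ->
  finite_controlled_pvar T p (swap_fun f).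
Proof.
rewrite /finite_controlled_pvar /square (@controlled_pvar_swap f)//.
exact: (rectangle_square T0).
Qed.

Lemma continuous_swap f : {within region (square T), continuous f} ->
  {within region (square T), continuous (swap_fun f)}.
Proof.
move=> cf; apply/subspace_continuousP => c sc.
apply/cvgrPdist_lt => e e0; rewrite near_withinE.
have sc' : region (square T) (c.2, c.1).
  by move: sc; rewrite !regionE/= andbC.
have [d d0 hd] := continuous_square_near cf sc' e0.
apply/nbhs_ballP; exists d => //= z [h1 h2] sz; apply: hd => //.
by move: sz; rewrite !regionE/= andbC.
Qed.

Lemma pnorm_swap f I J : rectangle T (I, J) ->
  pnorm f (I, J) = pnorm (swap_fun f) (J, I).
Proof. by move=> rA; rewrite /pnorm /pvar controlled_pvar_swap. Qed.

Lemma pvar_continuous f : finite_controlled_pvar T p f ->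
  {within region (square T), continuous f} ->
  {within rectangle T, continuous (pvar T p f)}.
Proof.
move=> fin cf; apply/subspace_continuousP => -[I J] rA.
apply/cvgrPdist_lt => e e0; rewrite near_withinE.
have pvarE A : pvar T p f A = `|pnorm f A| `^ p.
  by rewrite ger0_norm ?pnorm_ge0// powRVK// pvar_ge0.
(* Continuity of the p-th power reduces the claim to closeness of the norms. *)
have [d d0 hd] := norm_powR_near (pnorm f (I, J)) p0 e0.
have d30 : 0 < d / 3 by rewrite divr_gt0.
have d3 : d / 3 + d / 3 < d by lra.
have [dI dJ] := rA.
have [d1 d10 h1] := pnorm_near1 fin cf dI d30.
have [d2 d20 h2] := pnorm_near1 (finite_controlled_pvar_swap fin)
  (continuous_swap cf) dJ d30.
apply/nbhs_ballP; exists (Num.min d1 d2); first by rewrite /= lt_min d10.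
move=> [I' J'] [[/= n1 n2] [/= n3 n4]] [dI' dJ'].
move: n1 n2 n3 n4; rewrite /ball/= !lt_min.
move=> /andP[n1 _] /andP[n2 _] /andP[_ n3] /andP[_ n4].
change (`|pvar T p f (I, J) - pvar T p f (I', J')| < e).
rewrite !pvarE; apply: hd.
(* The path goes from (I, J) to (I, J') by the swapped estimate, then to (I', J'). *)
have k1 := h1 I' J' dI' dJ' n1 n2; have k2 := h2 J' I dJ' dI n3 n4.
rewrite -!pnorm_swap in k2; try by split.
apply: le_lt_trans (ler_distD (pnorm f (I, J')) _ _) _.
exact: le_lt_trans (lerD k2 k1) d3.
Qed.

Lemma pvar_control2D f : finite_controlled_pvar T p f ->
  {within region (square T), continuous f} -> control2D T (pvar T p f).
Proof.
move=> fin cf; split; [exact: pvar_continuous| |exact: pvar_super_additive].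
by move=> A rA dA; exact: pvar_degenerate.
Qed.

Lemma increment_le_pvar f A : finite_controlled_pvar T p f -> rectangle T A ->
  `|increment f A| `^ p <= pvar T p f A.
Proof.
move=> fin rA; apply: le_trans (pvar_ge T0 p1 fin rA (partition_set1 rA)).
by rewrite /pvar_sum big_seq_fset1.
Qed.

End Continuity.

Theorem theorem1 (R : realType) :
  (forall (T : R) (f : R * R -> R) (A : rect R),
     0 < T -> rectangle T A ->
     controlled_pvar T 1 f A = grid_pvar 1 f A) /\
  (forall p eps : R, 1 <= p -> 0 < eps ->
     exists2 c : R, 1 <= c &
       forall (T : R) (f : R * R -> R) (A : rect R),
         0 < T -> rectangle T A ->
         ((c^-1)%:E * controlled_pvar T (p + eps) f A <= grid_pvar p f A)%E /\
         (grid_pvar p f A <= controlled_pvar T p f A)%E) /\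
  (forall (T p : R) (f : R * R -> R),
     0 < T -> 1 <= p -> finite_controlled_pvar T p f ->
     (forall A, rectangle T A ->
        (controlled_pvar T p f A `^ p)%E \is a fin_num) /\
     super_additive T (fun A => fine (controlled_pvar T p f A `^ p)%E)) /\
  (forall (T p : R) (f : R * R -> R),
     0 < T -> 1 <= p ->
     {within region (square T), continuous f} ->
     finite_controlled_pvar T p f ->
     ((forall A, rectangle T A ->
         (controlled_pvar T p f A `^ p)%E \is a fin_num) /\
      control2D T (fun A => fine (controlled_pvar T p f A `^ p)%E)) /\
     exists w : rect R -> R, control2D T w /\
       forall A, rectangle T A -> `|increment f A| `^ p <= w A).
Proof.
split; [|split; [|split]].
- by move=> T f A _; exact: controlled_1var.
- move=> p eps p1 eps0; have [c c1 Hc] := controlled_pvar_le_grid p1 eps0.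
  exists c => // T f A _ rA; split; first exact: Hc.
  by apply: grid_pvar_le_controlled_pvar => //; exact: lt_le_trans p1.
- move=> T p f T0 p1 fin; split; last exact: (pvar_super_additive T0 p1 fin).
  by move=> A; exact: (pvar_fin_num T0 p1 fin).
move=> T p f T0 p1 cf fin; have ctrl := pvar_control2D T0 p1 fin cf.
split; first by split => // A; exact: (pvar_fin_num T0 p1 fin).
exists (pvar T p f); split => // A; exact: increment_le_pvar.
Qed.
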